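(* Any instance of the PP-problem with $n$ jobs, processing times $a_j,b_j$ ($j\in N$) and storage capacity $\Omega$ that satisfies $$3.5\,a_{max}+\max\{0.5\,a_{max},\,b_{max}\}\le \Omega,$$ where $a_{max}=\max_{i\in N}a_i$ and $b_{max}=\max_{i\in N}b_i$, can be solved (i.e. an optimal schedule can be found) in $O(n\log n)$ time.
   Context: PP-problem. An instance consists of a set of jobs $N=\{1,\dots,n\}$, nonnegative processing times $a_j$ and $b_j$ for each $j\in N$, and a storage capacity $\Omega$. Each job $j$ must be processed without interruption on the first-stage machine $M_1$ for $a_j$ time units and, after that, without interruption on the second-stage machine $M_2$ for $b_j$ time units. A schedule $\sigma$ specifies start times $S_j^1(\sigma)\ge 0$ and $S_j^2(\sigma)\ge 0$ on $M_1$ and $M_2$; the completion times are $C_j^1(\sigma)=S_j^1(\sigma)+a_j$ and $C_j^2(\sigma)=S_j^2(\sigma)+b_j$. The schedule is feasible if: (i) each machine processes at most one job at a time (for distinct jobs $i,j$ and each machine $M_k$, either $C_i^k(\sigma)\le S_j^k(\sigma)$ or $C_j^k(\sigma)\le S_i^k(\sigma)$); (ii) $S_j^2(\sigma)\ge C_j^1(\sigma)$ for every job $j$; (iii) each job $j$ occupies $a_j$ units of storage from $S_j^1(\sigma)$ until $C_j^2(\sigma)$, and at any time $t$ the total storage occupied, $\sum_{j:\,S_j^1(\sigma)\le t<C_j^2(\sigma)}a_j$, does not exceed $\Omega$. The goal is to find a feasible schedule minimising the makespan $C_{\max}(\sigma)=\max_{j\in N}C_j^2(\sigma)$. Running time is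 counted in elementary operations (arithmetic operations, rounding and comparisons on numbers have unit cost). *)

(* Defs.v *)
(* MathComp *)
From HB Require Import structures.
From mathcomp Require Import all_boot all_order all_algebra.

Set Implicit Arguments.
Unset Strict Implicit.
Unset Printing Implicit Defensive.

Import Order.TTheory GRing.Theory Num.Theory.
Local Open Scope ring_scope.

(* Numbers range over an arbitrary Archimedean ordered field R, such as the
   rationals or the reals. *)

Record instance (R : archiRealFieldType) (n : nat) := Instance {
  proc1 : 'I_n -> R;
  proc2 : 'I_n -> R;
  capacity : R;
  proc1_ge0 : forall j, 0 <= proc1 j;
  proc2_ge0 : forall j, 0 <= proc2 j
}.

(* The processing times are nonnegative, so starting the iterated maximum at 0
   does not change its value (and gives 0 when there is no job). *)
Definition amax (R : archiRealFieldType) (n : nat) (I : instance R n) : R :=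
  \big[Num.max/0]_(j < n) proc1 I j.

Definition bmax (R : archiRealFieldType) (n : nat) (I : instance R n) : R :=
  \big[Num.max/0]_(j < n) proc2 I j.

Record schedule (R : archiRealFieldType) (n : nat) := Schedule {
  start1 : 'I_n -> R;
  start2 : 'I_n -> R
}.

Definition compl1 (R : archiRealFieldType) (n : nat) (I : instance R n)
    (s : schedule R n) (j : 'I_n) : R := start1 s j + proc1 I j.

Definition compl2 (R : archiRealFieldType) (n : nat) (I : instance R n)
    (s : schedule R n) (j : 'I_n) : R := start2 s j + proc2 I j.

Definition storage_used (R : archiRealFieldType) (n : nat) (I : instance R n)
    (s : schedule R n) (t : R) : R :=
  \sum_(j < n | (start1 s j <= t) && (t < compl2 I s j)) proc1 I j.

Record feasible (R : archiRealFieldType) (n : nat) (I : instance R n)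
    (s : schedule R n) : Prop := Feasible {
  feasible_start1 : forall j, 0 <= start1 s j;
  feasible_start2 : forall j, 0 <= start2 s j;
  feasible_machine1 : forall i j, i != j ->
    compl1 I s i <= start1 s j \/ compl1 I s j <= start1 s i;
  feasible_machine2 : forall i j, i != j ->
    compl2 I s i <= start2 s j \/ compl2 I s j <= start2 s i;
  feasible_stages : forall j, compl1 I s j <= start2 s j;
  feasible_storage : forall t, storage_used I s t <= capacity I
}.

(* Completion times of feasible schedules are nonnegative. *)
Definition makespan (R : archiRealFieldType) (n : nat) (I : instance R n)
    (s : schedule R n) : R := \big[Num.max/0]_(j < n) compl2 I s j.

Definition optimal (R : archiRealFieldType) (n : nat) (I : instance R n)
    (s : schedule R n) : Prop :=
  feasible I s /\ forall s', feasible I s' -> makespan I s <= makespan I s'.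

(* A random access machine on numbers, presented as a structured programming
   language.  The memory consists of unbounded arrays indexed by nat; a program
   mentions finitely many of them, each by a fixed name (a nat), and holds a
   scalar variable in, say, cell 0 of an array.  Cell A e is the content of the
   cell of array A whose index is the value of e.  Programs contain only integer
   constants, hence do not depend on R. *)

Inductive expr :=
  | Const of int
  | Cell of nat & expr
  | Add of expr & expr
  | Sub of expr & expr
  | Mul of expr & expr
  | Div of expr & expr
  | Floor of expr.

Inductive test :=
  | Le of expr & expr
  | Not of test
  | And of test & test.

Inductive program :=
  | Skip
  | Store of nat & expr & expr
  | Seq of program & program
  | If of test & program & program
  | While of test & program.

Definition memory (R : Type) := nat -> nat -> R.

Definition update (R : Type) (m : memory R) (A i : nat) (x : R) : memory R :=
  fun A' i' => if (A' == A) && (i' == i) then x else m A' i'.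

(* Num.truncn rounds a nonnegative index down and sends a negative one to 0;
   it is the identity on natural numbers.  Division by 0 yields 0. *)
Fixpoint eval (R : archiRealFieldType) (m : memory R) (e : expr) : R :=
  match e with
  | Const k => k%:~R
  | Cell A e1 => m A (Num.truncn (eval m e1))
  | Add e1 e2 => eval m e1 + eval m e2
  | Sub e1 e2 => eval m e1 - eval m e2
  | Mul e1 e2 => eval m e1 * eval m e2
  | Div e1 e2 => eval m e1 / eval m e2
  | Floor e1 => (Num.floor (eval m e1))%:~R
  end.

Fixpoint holds (R : archiRealFieldType) (m : memory R) (b : test) : bool :=
  match b with
  | Le e1 e2 => eval m e1 <= eval m e2
  | Not b1 => ~~ holds m b1
  | And b1 b2 => holds m b1 && holds m b2
  end.

(* Every constant, memory access, arithmetic operation, rounding, comparison and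
   Boolean connective counts as one elementary operation. *)
Fixpoint expr_cost (e : expr) : nat :=
  match e with
  | Const _ => 1
  | Cell _ e1 | Floor e1 => (expr_cost e1).+1
  | Add e1 e2 | Sub e1 e2 | Mul e1 e2 | Div e1 e2 =>
      (expr_cost e1 + expr_cost e2).+1
  end.

Fixpoint test_cost (b : test) : nat :=
  match b with
  | Le e1 e2 => (expr_cost e1 + expr_cost e2).+1
  | Not b1 => (test_cost b1).+1
  | And b1 b2 => (test_cost b1 + test_cost b2).+1
  end.

(* exec p m t m': started in memory m, the program p halts after exactly t
   elementary operations, in memory m'. *)
Inductive exec (R : archiRealFieldType) :
    program -> memory R -> nat -> memory R -> Prop :=
  | ExecSkip m : exec Skip m 1 m
  | ExecStore A e1 e2 m :
      exec (Store A e1 e2) m (expr_cost e1 + expr_cost e2).+1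
        (update m A (Num.truncn (eval m e1)) (eval m e2))
  | ExecSeq p q m t1 m1 t2 m2 :
      exec p m t1 m1 -> exec q m1 t2 m2 -> exec (Seq p q) m (t1 + t2) m2
  | ExecIfTrue b p q m t m1 :
      holds m b -> exec p m t m1 -> exec (If b p q) m (test_cost b + t).+1 m1
  | ExecIfFalse b p q m t m1 :
      ~~ holds m b -> exec q m t m1 -> exec (If b p q) m (test_cost b + t).+1 m1
  | ExecWhileTrue b p m t1 m1 t2 m2 :
      holds m b -> exec p m t1 m1 -> exec (While b p) m1 t2 m2 ->
      exec (While b p) m (test_cost b + t1 + t2).+1 m2
  | ExecWhileFalse b p m :
      ~~ holds m b -> exec (While b p) m (test_cost b).+1 m.

Lemma exec_det (R : archiRealFieldType) (p : program) (m : memory R)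
    (t1 t2 : nat) (m1 m2 : memory R) :
  exec p m t1 m1 -> exec p m t2 m2 -> t1 = t2 /\ m1 = m2.
Proof.
move=> ex1; elim: ex1 t2 m2 => {p m t1 m1}
  [m|A e1 e2 m|p q m t1 m1 t1' m1' _ IHp _ IHq|b p q m t m1 hb _ IH
  |b p q m t m1 hb _ IH|b p m t1 m1 t1' m1' hb _ IHp _ IHw|b p m hb]
  t2 m2 ex2; inversion ex2; subst => //;
  repeat match goal with
  | Hb : is_true (holds ?m ?b), Hn : is_true (~~ holds ?m ?b) |- _ =>
      by rewrite Hb in Hn
  | IH : (forall t m', exec ?p ?m t m' -> _), H : exec ?p ?m _ _ |- _ =>
      case: (IH _ _ H) => ? ?; subst; clear H
  end; by [].
Qed.

(* Array 0 holds n and the storage capacity, arrays 1 and 2 hold the processing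
   times, and every other cell holds 0. *)
Definition input (R : archiRealFieldType) (n : nat) (I : instance R n) :
    memory R :=
  fun A i =>
    match A, i with
    | 0, 0 => n%:R
    | 0, 1 => capacity I
    | 1, _ => oapp (proc1 I) 0 (insub i)
    | 2, _ => oapp (proc2 I) 0 (insub i)
    | _, _ => 0
    end.

(* The start times are read off from arrays 3 and 4. *)
Definition output (R : archiRealFieldType) (n : nat) (m : memory R) :
    schedule R n :=
  Schedule (fun j : 'I_n => m 3%N j) (fun j : 'I_n => m 4%N j).

(* T is O(f), both read as functions of the number of jobs. *)
Definition bigO (T f : nat -> nat) : Prop :=
  exists c n0 : nat, forall n, (n0 <= n)%N -> (T n <= c * f n)%N.

(* trunc_log 2 n is the integer part of the binary logarithm of n > 0. *)
Definition nlogn (n : nat) : nat := (n * trunc_log 2 n)%N.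

(* Main.v *)
(* Put d j = b j - a j.  An order of the jobs is timed by starting every job as
   early as possible on M2 and then, going backwards, as late as possible on M1.
   For the job x in position i let D be the sum of d over the earlier jobs, and
   let high i = D + b x and low i = D - a x.  The resulting makespan is
   sum b - min low, and the storage never exceeds amax plus the largest
   difference between a high and a low, where it suffices to compare every high
   with the later lows only, or every high with the earlier lows only.
   Johnson's order (the jobs with a <= b by increasing a, then the others by
   decreasing b) minimizes sum b - min low but its highs are unbounded.  The two
   lists are therefore interleaved: the next job of the second list is taken as
   soon as this leaves D at least L + amax, where L is the least low of the jobs
   taken from the first list so far.  All lows are at least L until one of
   the lists is exhausted, the jobs that determine L and those of the final stretch
   are bounded as in Johnson's order, and until then the highs are at most
   L + 2 amax + bmax, so that a capacity of 3 amax + bmax is enough.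
   Sorting by bottom-up merge sort dominates the running time. *)
Require Import Defs.
From mathcomp Require Import all_boot all_order all_algebra.
From mathcomp Require Import ring lra zify.
Import Order.TTheory GRing.Theory Num.Theory.
Local Open Scope ring_scope.
Set Implicit Arguments.
Unset Strict Implicit.
Unset Printing Implicit Defensive.

(** * Lower bounds for the makespan *)

Section LowerBounds.

Variables (R : archiRealFieldType) (n : nat) (I : instance R n).

Notation a := (proc1 I).
Notation b := (proc2 I).

Let a_ge0 j : 0 <= a j. Proof. exact: proc1_ge0. Qed.
Let b_ge0 j : 0 <= b j. Proof. exact: proc2_ge0. Qed.

Lemma le_amax j : a j <= amax I.
Proof. exact: (le_bigmax (0 : R) a). Qed.

Lemma le_bmax j : b j <= bmax I.
Proof. exact: (le_bigmax (0 : R) b). Qed.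

Lemma amax_ge0 : 0 <= amax I.
Proof. exact: bigmax_ge_id. Qed.

Lemma bmax_ge0 : 0 <= bmax I.
Proof. exact: bigmax_ge_id. Qed.

(* Jobs of length zero may start anywhere, even at the end of the last job of
   positive length; hence the condition on [p i]. *)
Lemma sum_disjoint_le (p S : 'I_n -> R) (V : {set 'I_n}) (x y : R) :
    (forall i, 0 <= p i) -> x <= y ->
    (forall i j, i != j -> S i + p i <= S j \/ S j + p j <= S i) ->
    (forall i, i \in V -> 0 < p i -> x <= S i /\ S i + p i <= y) ->
  \sum_(i in V) p i <= y - x.
Proof.
move=> p0 + disj.
have [k] := ubnP #|V|; elim: k V y => // k IH V y /ltnSE Vk xy inV.
have [/existsP[i0 /andP[i0V pi0]]|] := boolP [exists i, (i \in V) && (0 < p i)]; last first.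
  move=> /existsPn noV; rewrite big1 ?subr_ge0 // => i iV.
  by move: (noV i); rewrite iV /= -leNgt => pi; apply/eqP; rewrite eq_le pi p0.
(* Among the jobs of positive length the one completing last is removed; by disjointness the others
   end before it starts, so the window shrinks to [[x, S m]]. *)
case: (@arg_maxP _ _ _ i0 (fun i => (i \in V) && (0 < p i)) (fun i => S i + p i)).
  by rewrite i0V.
move=> m /andP[mV pm] mmax; rewrite (big_setD1 m) //=.
have [xm my] := inV _ mV pm.
have : \sum_(i in V :\ m) p i <= S m - x.
  apply: IH => //; first by rewrite (cardsD1 m V) mV in Vk.
  move=> i /setD1P[im iV] pi; have [xi iy] := inV _ iV pi; split=> //.
  have := mmax i; rewrite iV pi => /(_ isT) /= ?.
  by case: (disj _ _ im) => // ?; lra.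
by lra.
Qed.

Variables (s : schedule R n) (fs : feasible I s).

Lemma le_makespan j : compl2 I s j <= makespan I s.
Proof. exact: (le_bigmax (0 : R) (compl2 I s)). Qed.

(** Let [l] be the job that completes first on M1 among those with [a >= th], and [tau] its
    completion time there. The jobs completing on M1 before [tau] are all shorter than [th], and
    their work on M1 fits before [tau] together with [th]. Every other job starts on M2 after [tau],
    so its work on M2 fits between [tau] and the makespan. *)
Lemma makespan_ge_first_stage (th : R) (j0 : 'I_n) : th <= a j0 ->
  th + \sum_j (if a j < th then Num.min (a j) (b j) else b j) <= makespan I s.
Proof.
move=> j0th.
case: (@arg_minP _ _ _ j0 (fun j => th <= a j) (compl1 I s) j0th) => l lth lmin.
set tau := compl1 I s l in lmin.
have c1_lt j : compl1 I s j < tau -> a j < th.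
  by move=> jtau; rewrite ltNge; apply/negP => /lmin; rewrite leNgt jtau.
have S1_ge0 j := feasible_start1 fs j.
have l0 : l \notin [set j | compl1 I s j < tau] by rewrite inE ltxx.
have sumA : th + \sum_(j in [set j | compl1 I s j < tau]) a j <= tau.
  have : \sum_(j in l |: [set j | compl1 I s j < tau]) a j <= tau - 0.
    apply: (sum_disjoint_le (S := start1 s)) => //.
    - by rewrite addr_ge0.
    - exact: feasible_machine1 fs.
    - by move=> j; rewrite !inE => /orP[/eqP->|/ltW].
  by rewrite big_setU1 //= subr0; apply: le_trans; rewrite lerD2r.
have sumB : \sum_(j in ~: [set j | compl1 I s j < tau]) b j <= makespan I s - tau.
  apply: (sum_disjoint_le (S := start2 s)) => //.
  - apply: le_trans (le_makespan l); rewrite /compl2.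
    by apply: le_trans (feasible_stages fs l) _; rewrite lerDl.
  - exact: feasible_machine2 fs.
  - move=> j; rewrite !inE -leNgt => jtau _; split; last exact: le_makespan.
    exact: le_trans jtau (feasible_stages fs j).
rewrite (bigID (mem [set j | compl1 I s j < tau])) /=.
have leA : \sum_(j in [set j | compl1 I s j < tau])
    (if a j < th then Num.min (a j) (b j) else b j)
    <= \sum_(j in [set j | compl1 I s j < tau]) a j.
  by apply: ler_sum => j; rewrite inE => /c1_lt ->; rewrite ge_min lexx.
have leB : \sum_(j | j \notin [set j | compl1 I s j < tau])
    (if a j < th then Num.min (a j) (b j) else b j)
    <= \sum_(j in ~: [set j | compl1 I s j < tau]) b j.
  rewrite [leRHS](eq_bigl (fun j => j \notin [set j | compl1 I s j < tau])); last first.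
    by move=> j; rewrite /= !inE.
  by apply: ler_sum => j _; case: ifP => // _; rewrite ge_min lexx orbT.
by move: sumA sumB leA leB; lra.
Qed.

(** The time reversal of the previous bound: [l] is now the job that starts last on M2 among those
    with [b >= th], and [tau] is its start. Jobs starting later on M2 have [b < th]; all others have
    left M1 by [tau]. *)
Lemma makespan_ge_second_stage (th : R) (j0 : 'I_n) : th <= b j0 ->
  th + \sum_j (if b j < th then Num.min (a j) (b j) else a j) <= makespan I s.
Proof.
move=> j0th.
case: (@arg_maxP _ _ _ j0 (fun j => th <= b j) (start2 s) j0th) => l lth lmax.
set tau := start2 s l in lmax.
have s2_gt j : tau < start2 s j -> b j < th.
  by move=> jtau; rewrite ltNge; apply/negP => /lmax; rewrite /= leNgt jtau.
set V := [set j | tau < start2 s j].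
have l0 : l \notin V by rewrite inE ltxx.
have sumB : th + \sum_(j in V) b j <= makespan I s - tau.
  have : \sum_(j in l |: V) b j <= makespan I s - tau.
    apply: (sum_disjoint_le (S := start2 s)) => //.
    - by apply: le_trans (le_makespan l); rewrite /compl2 lerDl.
    - exact: feasible_machine2 fs.
    - move=> j jV _; split; last exact: le_makespan.
      by case/setU1P: jV => [->//|]; rewrite inE => /ltW.
  by rewrite big_setU1 //=; apply: le_trans; rewrite lerD2r.
have sumA : \sum_(j in ~: V) a j <= tau - 0.
  apply: (sum_disjoint_le (S := start1 s)) => //.
  - exact: feasible_start2 fs l.
  - exact: feasible_machine1 fs.
  - move=> j; rewrite !inE -leNgt => jtau _; split; first exact: feasible_start1 fs j.
    exact: le_trans (feasible_stages fs j) jtau.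
rewrite (bigID (mem V)) /=.
have leB : \sum_(j in V) (if b j < th then Num.min (a j) (b j) else a j)
    <= \sum_(j in V) b j.
  by apply: ler_sum => j; rewrite inE => /s2_gt ->; rewrite ge_min lexx orbT.
have leA : \sum_(j | j \notin V) (if b j < th then Num.min (a j) (b j) else a j)
    <= \sum_(j in ~: V) a j.
  rewrite [leRHS](eq_bigl (fun j => j \notin V)); last first.
    by move=> j; rewrite /= !inE.
  by apply: ler_sum => j _; case: ifP => // _; rewrite ge_min lexx.
by move: sumA sumB leA leB; lra.
Qed.

End LowerBounds.

(** * The timetable of an order *)

Section Timetable.

Variables (R : archiRealFieldType) (n : nat) (A B : nat -> R).

Definition psum (F : nat -> R) (k : nat) : R := \sum_(0 <= i < k) F i.

Lemma psumS F k : psum F k.+1 = psum F k + F k.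
Proof. by rewrite /psum big_nat_recr. Qed.

Lemma psum0 F : psum F 0 = 0.
Proof. by rewrite /psum big_geq. Qed.

(** M1 runs without idle time in the earliest schedule, so the job in position [k] leaves it at
    [psum A k.+1]; [finish2 k] is the time at which M2 is done with the first [k] jobs. *)
Fixpoint finish2 (k : nat) : R :=
  if k is k'.+1 then Num.max (psum A k) (finish2 k') + B k' else 0.

Definition begin2 (k : nat) : R := Num.max (psum A k.+1) (finish2 k).

(* [begin1_rev r] is the start on M1 of the [r]-th job from the end; for [r = 0]
   it is a bound that does not constrain the last job. *)
Fixpoint begin1_rev (r : nat) : R :=
  if r is r'.+1 then Num.min (begin2 (n - r)) (begin1_rev r') - A (n - r)
  else finish2 n.

Definition begin1 (k : nat) : R := begin1_rev (n - k).

Lemma finish2S k : finish2 k.+1 = begin2 k + B k. Proof. by []. Qed.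

Lemma begin1_n : begin1 n = finish2 n.
Proof. by rewrite /begin1 subnn. Qed.

Lemma begin1E k : (k < n)%N -> begin1 k = Num.min (begin2 k) (begin1 k.+1) - A k.
Proof.
move=> kn; rewrite /begin1 (_ : n - k = (n - k.+1).+1)%N; last by lia.
by rewrite /= (_ : n - (n - k.+1).+1 = k)%N //; lia.
Qed.

Hypotheses (A_ge0 : forall i, 0 <= A i) (B_ge0 : forall i, 0 <= B i).

Lemma psum_ge0 F k : (forall i, 0 <= F i) -> 0 <= psum F k.
Proof. by move=> F0; apply: sumr_ge0 => i _. Qed.

Lemma psum_le F i k : (forall i, 0 <= F i) -> (i <= k)%N -> psum F i <= psum F k.
Proof.
move=> F0 /subnK <-; elim: (k - i)%N => // d IH.
by rewrite addSn psumS; have := F0 (d + i)%N; lra.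
Qed.

Lemma finish2_ge0 k : 0 <= finish2 k.
Proof.
by elim: k => // k IH; rewrite /= addr_ge0 // le_max IH orbT.
Qed.

Lemma finish2_le_begin2 k : finish2 k <= begin2 k.
Proof. by rewrite le_max lexx orbT. Qed.

Lemma psum_le_begin2 k : psum A k.+1 <= begin2 k.
Proof. by rewrite le_max lexx. Qed.

Lemma finish2_busy j l : (j <= l)%N ->
  finish2 j + (psum B l - psum B j) <= finish2 l.
Proof.
move=> /subnK <-; elim: (l - j)%N => [|d IH]; first by rewrite subrr addr0.
rewrite addSn psumS finish2S; have := finish2_le_begin2 (d + j); lra.
Qed.

Lemma finish2_le j l : (j <= l)%N -> finish2 j <= finish2 l.
Proof.
move=> jl; have := finish2_busy jl; have := psum_le B_ge0 jl; lra.
Qed.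

Lemma finish2_le_begin2_lt j l : (j < l)%N -> finish2 j.+1 <= begin2 l.
Proof. by move=> /finish2_le ?; apply: le_trans (finish2_le_begin2 l). Qed.

(* [i] is the job that opens the busy period of M2 containing job [j]. *)
Lemma finish2_path j : exists2 i, (i <= j)%N &
  finish2 j.+1 = psum A i.+1 + (psum B j.+1 - psum B i).
Proof.
elim: j => [|j [i ij E]].
  exists 0%N => //; rewrite !finish2S /begin2 /= !psumS !psum0 max_l; first by ring.
  by rewrite add0r.
rewrite finish2S /begin2; case: leP => [_|_].
  by exists i; [exact: leqW | rewrite E (psumS B j.+1); ring].
by exists j.+1 => //; rewrite (psumS B j.+1); ring.
Qed.

(** The counterpart of [finish2_path] on M1: from job [k] on, M1 works without a gap up to some job
    [l], which goes straight on to M2. The initial bound [finish2 n] is never attained, because the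
    last job has to start on M2 before it. *)
Lemma begin1_path k : (k < n)%N -> exists2 l, (k <= l < n)%N &
  begin1 k = begin2 l - (psum A l.+1 - psum A k).
Proof.
move=> kn; have [r] := ubnPeq (n - k)%N.
elim: r k kn => [|r IH] k kn; first by lia.
move=> nk; have [kn1|] := ltnP k.+1 n; last first.
  move=> nk1; have {nk1}kE : n = k.+1 by lia.
  have E : begin1 k.+1 = begin2 k + B k by rewrite -finish2S -kE begin1_n.
  exists k; rewrite ?kn ?leqnn // begin1E // E min_l; last by rewrite lerDl.
  by rewrite psumS; ring.
have [|l /andP[kl ln] E] := IH k.+1 kn1; first by lia.
rewrite begin1E //; case: leP => [_|_].
  by exists k; rewrite ?leqnn // psumS; ring.
by exists l; rewrite ?ln 1?ltnW // E (psumS A k); ring.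
Qed.

Lemma begin1_ge k : (k < n)%N -> psum A k <= begin1 k.
Proof.
move=> /begin1_path[l _ ->]; have := psum_le_begin2 l; lra.
Qed.

Lemma begin1_begin2 k : (k < n)%N -> begin1 k + A k <= begin2 k.
Proof. by move=> kn; rewrite begin1E // subrK ge_min lexx. Qed.

Lemma begin1S k : (k < n)%N -> begin1 k + A k <= begin1 k.+1.
Proof. by move=> kn; rewrite begin1E // subrK ge_min lexx orbT. Qed.

Lemma begin1_lt i k : (i < k < n)%N -> begin1 i + A i <= begin1 k.
Proof.
move=> /andP[ik kn]; have := kn; have := ik; move: kn => _.
move: ik => /subnK <-; elim: (k - i.+1)%N => [|d IH] _.
  by rewrite add0n => ?; apply: begin1S; lia.
rewrite addSn => kn; apply: le_trans (IH _ _) _; [lia|lia|].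
have := @begin1S (d + i.+1)%N; have := A_ge0 (d + i.+1)%N => ? /(_ (ltnW kn)); lra.
Qed.

Definition high (j : nat) : R := psum B j - psum A j + B j.
Definition low (i : nat) : R := psum B i - psum A i - A i.

(* The job [k] starts on M1 at [begin2 l - (psum A l.+1 - psum A k)] for some
   [l >= k].  With the first kind of window, [begin2 l] is bounded below by the
   work of M2 after job [j]; with the second kind, by the work of M1 alone, and
   [finish2 j.+1] is expanded along its busy period. *)
Lemma storage_interval (K : R) j k :
    (forall i l, (i < l < n)%N -> high i - low l <= K) \/
    (forall i l, (i <= l < n)%N -> high l - low i <= K) ->
    (j < k < n)%N -> begin1 k < finish2 j.+1 ->
  psum A k - psum A j < K.
Proof.
move=> window /andP[jk kn]; have [l /andP[kl ln] ->] := begin1_path kn.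
have := finish2_le_begin2 l; have := psum_le_begin2 l.
case: window => window.
- have jl : (j < l)%N by lia.
  have := finish2_busy jl; have := window j l; rewrite jl ln => /(_ isT).
  rewrite /high /low (psumS A l) (psumS B j); lra.
- have [i ij ->] := finish2_path j.
  have := window i j; rewrite ij (ltn_trans jk kn) => /(_ isT).
  rewrite /high /low !psumS; lra.
Qed.

Variables (I : instance R n) (pos : 'I_n -> 'I_n).
Hypotheses (pos_inj : injective pos) (A_pos : forall j, A (pos j) = proc1 I j)
  (B_pos : forall j, B (pos j) = proc2 I j).

Definition timetable : schedule R n :=
  Schedule (fun j => begin1 (pos j)) (fun j => begin2 (pos j)).

Lemma compl2_timetable j : compl2 I timetable j = finish2 (pos j).+1.
Proof. by rewrite /compl2 -B_pos finish2S. Qed.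

Lemma makespan_timetable : makespan I timetable <= finish2 n.
Proof.
apply: bigmax_le => [|j _]; first exact: finish2_ge0.
by rewrite compl2_timetable; apply: finish2_le.
Qed.

Lemma storage_timetable t : storage_used I timetable t =
  \sum_(i < n | (begin1 i <= t) && (t < finish2 i.+1)) A i.
Proof.
rewrite /storage_used [RHS](reindex_inj pos_inj) /=.
by apply: eq_big => j; rewrite ?compl2_timetable ?A_pos.
Qed.

(** The jobs in storage at time [t] lie between the first such position [j] and the last one [k].
    Job [k] has started by [t], before job [j] is completed, so [storage_interval] bounds the
    positions from [j] up to [k], exclusive, by [K], and job [k] adds at most amax. The bound on
    amax alone serves when at most one position is involved. *)
Lemma feasible_timetable (K : R) : K + amax I <= capacity I ->
    (forall i l, (i < l < n)%N -> high i - low l <= K) \/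
    (forall i l, (i <= l < n)%N -> high l - low i <= K) ->
    amax I <= capacity I ->
  feasible I timetable.
Proof.
move=> KO window aO.
have begin1_ge0 (j : 'I_n) : 0 <= begin1 j.
  by apply: le_trans (begin1_ge (ltn_ord j)); apply: psum_ge0.
have order i j : i != j ->
    (pos i < pos j < n)%N \/ (pos j < pos i < n)%N.
  rewrite -(inj_eq pos_inj) -val_eqE neq_ltn !ltn_ord !andbT.
  by case/orP; [left|right].
have le_amax (i : 'I_n) : A i <= amax I.
  have [pos' _ posK'] : bijective pos by exact: injF_bij.
  by rewrite -[i]posK' A_pos; apply: (le_bigmax (0 : R) (proc1 I)).
split=> [j|j|i j /order ij|i j /order ij|j|t].
- exact: begin1_ge0.
- by apply: le_trans (finish2_le_begin2 _); apply: finish2_ge0.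
- by rewrite /compl1 -!A_pos; case: ij => /begin1_lt ?; [left|right].
- rewrite !compl2_timetable; case: ij => /andP[/finish2_le_begin2_lt ? _];
  by [left|right].
- by rewrite /compl1 -A_pos; apply: begin1_begin2.
rewrite storage_timetable.
set P := fun i : 'I_n => (begin1 i <= t) && (t < finish2 i.+1).
have [i0 Pi0|noP] := pickP P; last first.
  rewrite big_pred0; first by apply: le_trans aO; apply: bigmax_ge_id.
  by move=> i; apply: noP.
case: (@arg_minnP _ i0 P (fun i : 'I_n => i : nat) Pi0) => j /andP[_ tj] jmin.
case: (@arg_maxnP _ i0 P (fun i : 'I_n => i : nat) Pi0) => k Pk kmax.
have /andP[kt _] := Pk.
have jk : (j <= k)%N by apply: jmin.
have sum_le : \sum_(i < n | P i) A i <= psum A k.+1 - psum A j.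
  have -> : psum A k.+1 - psum A j = \sum_(j <= i < k.+1) A i.
    rewrite /psum (@big_cat_nat _ _ _ j 0 k.+1) //=; last by lia.
    by rewrite addrC addrK.
  rewrite (big_nat_widenl _ 0%N) // (big_nat_widen _ _ n) // big_mkord.
  rewrite big_mkcond [leRHS]big_mkcond /=; apply: ler_sum => i _.
  case: ifP => [Pi|_]; last by case: ifP.
  by rewrite jmin // ltnS; have /= -> := kmax _ Pi.
have [jk1|kj] := ltnP j k; last first.
  have kjE : nat_of_ord k = j by lia.
  have := le_amax j; rewrite kjE psumS in sum_le; lra.
have := @storage_interval K j k window; rewrite jk1 ltn_ord => /(_ isT).
move=> /(_ (le_lt_trans kt tj)); have := le_amax k.
rewrite psumS in sum_le; lra.
Qed.

End Timetable.

(** * The order of the jobs *)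

Lemma cat_split (T : Type) (u v s1 s2 : seq T) (x : T) :
    u ++ v = s1 ++ x :: s2 ->
  (exists u2, u = s1 ++ x :: u2) \/
  (exists2 v1, s1 = u ++ v1 & v = v1 ++ x :: s2).
Proof.
elim: u s1 => [|y u IH] [|z s1] /=.
- by move=> ->; right; exists [::].
- by move=> ->; right; exists (z :: s1).
- by case=> -> _; left; exists u.
- case=> -> /IH[[u2 ->]|[v1 -> ->]]; first by left; exists u2.
  by right; exists v1.
Qed.

Lemma rcons_split (T : Type) (u s1 s2 : seq T) (x y : T) :
    rcons u y = s1 ++ x :: s2 ->
  (exists u2, u = s1 ++ x :: u2) \/ s1 = u /\ x = y.
Proof.
rewrite -cats1 => E; case: (cat_split E) => [?|[v1 -> {E}]]; first by left.
case: v1 => [|z [|? ?]] //= [-> _].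
by right; rewrite cats0.
Qed.

Lemma split_nested (T : Type) (s1 s2 s3 s4 : seq T) (x y : T) :
    s1 ++ x :: s2 = s3 ++ y :: s4 -> (size s1 < size s3)%N ->
  exists r, s3 = s1 ++ x :: r.
Proof.
move=> E lt; case: (cat_split (esym E)) => [[u2 ->]|[v1 s1E _]]; first by exists u2.
move: lt; rewrite s1E.
by rewrite size_cat ltnNge leq_addr.
Qed.

(** * Interleaving the two lists of Johnson's order *)

Section Mix.

Variables (R : archiRealFieldType) (T : eqType) (a b : T -> R) (M : R).

(* [D] is the excess of the jobs taken so far and [L] the least [low] of those
   taken from [ps]. *)
Fixpoint mix (ps : seq T) : seq T -> R -> R -> seq T :=
  if ps is p :: ps' then
    fix mix_ps (qs : seq T) (D L : R) : seq T :=
      if qs is q :: qs' then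
        if L + M <= D + (b q - a q) then q :: mix_ps qs' (D + (b q - a q)) L
        else p :: mix ps' qs (D + (b p - a p)) (Num.min L (D - a p))
      else ps
  else fun qs _ _ => qs.

Lemma mix0s qs D L : mix [::] qs D L = qs. Proof. by []. Qed.

Lemma mixs0 ps D L : mix ps [::] D L = ps. Proof. by case: ps. Qed.

Lemma mix_cons p ps q qs D L : mix (p :: ps) (q :: qs) D L =
  if L + M <= D + (b q - a q) then q :: mix (p :: ps) qs (D + (b q - a q)) L
  else p :: mix ps (q :: qs) (D + (b p - a p)) (Num.min L (D - a p)).
Proof. by []. Qed.

Definition excess (u : seq T) : R := \sum_(x <- u) (b x - a x).

Lemma excess_cat u v : excess (u ++ v) = excess u + excess v.
Proof. exact: big_cat. Qed.

Lemma excess_cons x u : excess (x :: u) = b x - a x + excess u.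
Proof. exact: big_cons. Qed.

Lemma excess_nil : excess [::] = 0. Proof. exact: big_nil. Qed.

Lemma excess_rcons u x : excess (rcons u x) = excess u + (b x - a x).
Proof. by rewrite -cats1 excess_cat excess_cons excess_nil addr0. Qed.

Lemma excess_ge0 u : all (fun x => a x <= b x) u -> 0 <= excess u.
Proof.
move=> /allP uP; rewrite /excess big_seq; apply: sumr_ge0 => x /uP ?.
by rewrite subr_ge0.
Qed.

Lemma excess_le0 u : all (fun x => b x < a x) u -> excess u <= 0.
Proof.
move=> /allP uP; rewrite /excess big_seq; apply: sumr_le0 => x /uP ?.
by rewrite subr_le0 ltW.
Qed.

Variables (Bm LB : R) (jobs : seq T).
Hypotheses (a_ge0 : forall x, 0 <= a x) (b_ge0 : forall x, 0 <= b x).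
Hypotheses (a_le : forall x, a x <= M) (b_le : forall x, b x <= Bm).
Hypothesis first_stage : forall x, x \in jobs ->
  a x + \sum_(y <- jobs) (if a y < a x then Num.min (a y) (b y) else b y) <= LB.
Hypothesis second_stage : forall x, x \in jobs ->
  b x + \sum_(y <- jobs) (if b y < b x then Num.min (a y) (b y) else a y) <= LB.

Let M_ge0 (x : T) : 0 <= M. Proof. exact: le_trans (a_ge0 x) (a_le x). Qed.

Let total : R := \sum_(x <- jobs) b x.
Let K : R := 2 * M + Bm.

(** The left-hand side is [a p] plus the sum of [a] over [u] and of [b] over the remaining jobs.
    With the threshold [a p], the first-stage bound counts every job by at least that much. *)
Lemma first_stage_prefix u p ps qs :
    perm_eq (u ++ p :: ps ++ qs) jobs -> all (fun x => a x <= b x) u ->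
    all (fun x => a p <= a x) ps -> all (fun x => b x < a x) qs ->
  total - (excess u - a p) <= LB.
Proof.
move=> jobsE /allP uP /allP psP /allP qsQ.
have pin : p \in jobs by rewrite -(perm_mem jobsE) mem_cat inE eqxx orbT.
have := first_stage pin; rewrite /total -!(perm_big _ jobsE) /=.
rewrite !big_cat !big_cons !big_cat /= ltxx.
set F := fun y => if a y < a p then Num.min (a y) (b y) else b y.
have leu : \sum_(x <- u) a x <= \sum_(x <- u) F x.
  rewrite big_seq [leRHS]big_seq; apply: ler_sum => x /uP ab; rewrite /F.
  by case: ifP => // _; rewrite le_min lexx.
have leps : \sum_(x <- ps) b x <= \sum_(x <- ps) F x.
  rewrite big_seq [leRHS]big_seq; apply: ler_sum => x /psP ab; rewrite /F.
  by rewrite ltNge ab.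
have leqs : \sum_(x <- qs) b x <= \sum_(x <- qs) F x.
  rewrite big_seq [leRHS]big_seq; apply: ler_sum => x /qsQ /ltW ba; rewrite /F.
  by case: ifP => // _; rewrite le_min lexx ba.
rewrite /excess sumrB -/(F p); lra.
Qed.

(** The left-hand side is [b q] plus the sum of [a] over [u], [q1], [q] and of [b] over [q2]; the
    second-stage bound with threshold [b q] dominates it term by term. A job of [u] with [b < b q]
    must have [a <= b], so its minimum is [a]. *)
Lemma second_stage_suffix u q1 q q2 :
    perm_eq (u ++ q1 ++ q :: q2) jobs ->
    {in u, forall x, b x < a x -> b q <= b x} ->
    all (fun x => b q <= b x) q1 -> all (fun x => b x <= b q) q2 ->
    all (fun x => b x < a x) (q1 ++ q :: q2) ->
  total - (excess (u ++ q1) - a q) <= LB.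
Proof.
move=> jobsE uQ /allP q1P /allP q2P.
rewrite all_cat /= => /and3P[/allP q1Q qQ /allP q2Q].
have qin : q \in jobs by rewrite -(perm_mem jobsE) !mem_cat inE eqxx !orbT.
have := second_stage qin; rewrite /total -!(perm_big _ jobsE) /=.
rewrite !big_cat !big_cons /= ltxx.
set F := fun y => if b y < b q then Num.min (a y) (b y) else a y.
have leu : \sum_(x <- u) a x <= \sum_(x <- u) F x.
  rewrite big_seq [leRHS]big_seq; apply: ler_sum => x /uQ ab; rewrite /F.
  case: ltP => // bq; rewrite le_min lexx /= leNgt.
  by apply/negP => /ab; rewrite leNgt bq.
have leq1 : \sum_(x <- q1) a x <= \sum_(x <- q1) F x.
  rewrite big_seq [leRHS]big_seq; apply: ler_sum => x /q1P ab; rewrite /F.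
  by rewrite ltNge ab.
have leq2 : \sum_(x <- q2) b x <= \sum_(x <- q2) F x.
  rewrite big_seq [leRHS]big_seq; apply: ler_sum => x xq; rewrite /F.
  have /ltW ba := q2Q _ xq.
  by case: ifP => // _; rewrite le_min lexx ba.
rewrite excess_cat /excess !sumrB; lra.
Qed.

(* [u] is the part of the order that precedes the exhaustion of one of the
   lists.  [LB] is a lower bound for the makespan and [mix_legit] says that a job
   with low [L] does not violate it.  In the first phase of [mix_phase] no
   further job lowers [L]; in the second one [u] is a prefix of Johnson's
   order. *)
Record mix_inv (u ps qs : seq T) (L : R) : Prop := MixInv {
  mix_perm : perm_eq (u ++ ps ++ qs) jobs;
  mix_ps : all (fun x => a x <= b x) ps;
  mix_qs : all (fun x => b x < a x) qs;
  mix_ps_sorted : pairwise (fun x y => a x <= a y) ps;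
  mix_qs_sorted : pairwise (fun x y => b y <= b x) qs;
  mix_done : {in u, forall x, b x < a x -> {in qs, forall y, b y <= b x}};
  mix_low : forall s1 x s2, u = s1 ++ x :: s2 -> L <= excess s1 - a x;
  mix_high : forall s1 x s2, u = s1 ++ x :: s2 -> excess s1 + b x <= L + K;
  mix_legit : u = [::] /\ L = 0 \/ total - L <= LB;
  mix_phase : L + M <= excess u \/
    all (fun x => a x <= b x) u /\
    forall s1 x s2, u = s1 ++ x :: s2 -> excess s1 + b x <= excess u + M;
  mix_head : forall q qs', qs = q :: qs' -> excess u + (b q - a q) <= L + M + Bm
}.

Lemma mix_inv0 ps qs :
    perm_eq (ps ++ qs) jobs ->
    all (fun x => a x <= b x) ps -> all (fun x => b x < a x) qs ->
    pairwise (fun x y => a x <= a y) ps -> pairwise (fun x y => b y <= b x) qs ->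
  mix_inv [::] ps qs 0.
Proof.
move=> ? ? qsQ ? ?; split=> //; try by case.
- by left.
- by right; split=> // -[].
- move=> q qs' qE; move: qsQ; rewrite qE /= excess_nil => /andP[qQ _].
  have := M_ge0 q; have := le_trans (b_ge0 q) (b_le q); lra.
Qed.

(** The test and [b q < a q <= M] give the new low [excess u - a q >= L], so [L] stays. The bound
    [mix_head] on the excess after [q], increased by [a q <= M], bounds the new high. *)
Lemma mix_inv_q u p ps q qs L :
    mix_inv u (p :: ps) (q :: qs) L -> L + M <= excess u + (b q - a q) ->
  mix_inv (rcons u q) (p :: ps) qs L.
Proof.
case=> perm_u psP /= /andP[qQ qsQ] ps_s /andP[/allP q_min qs_s] done_u low_u high_u legit
  phase head /= test.
have := head _ _ erefl; have := a_le q; have := b_le q.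
have := a_ge0 q; have := b_ge0 q; have := M_ge0 q => ? ? ? ? ? ?.
split=> //.
- apply: perm_trans perm_u; rewrite -cats1 -catA perm_cat2l.
  by rewrite (perm_catCA [:: q] (p :: ps) qs).
- move=> x; rewrite mem_rcons inE => /predU1P[->|xu] xQ y yqs; first exact: q_min.
  by apply: (done_u x) => //; rewrite inE yqs orbT.
- by move=> s1 x s2 E; case: (rcons_split E) => [[u2 /low_u]|[-> ->]] //; lra.
- by move=> s1 x s2 E; case: (rcons_split E) => [[u2 /high_u]|[-> ->]] //; rewrite /K; lra.
- case: legit => [[uE LE]|]; last by right.
  by move: test; rewrite uE LE excess_nil; lra.
- by left; rewrite excess_rcons.
- move=> q2 qs' qE; move: qsQ; rewrite qE /= excess_rcons => /andP[]; lra.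
Qed.

(** The failed test bounds [excess u] by [L + M + a q - b q], hence the new high. In the first phase
    [excess u - a p >= L], so the minimum does not move. It can therefore only drop while [u] is a
    prefix of Johnson's order; then the first-stage bound at [p] justifies the new value, and the
    older highs are compared with [excess u] instead of [L]. *)
Lemma mix_inv_p u p ps q qs L :
    mix_inv u (p :: ps) (q :: qs) L -> excess u + (b q - a q) < L + M ->
  mix_inv (rcons u p) ps (q :: qs) (Num.min L (excess u - a p)).
Proof.
case=> perm_u /= /andP[pP psP] qsQ /andP[p_min ps_s] qs_s done_u low_u high_u legit
  phase head test.
have := a_le q; have := b_le q; have := a_le p; have := b_le p.
have := a_ge0 q; have := b_ge0 q; have := a_ge0 p; have := b_ge0 p.
have := M_ge0 q => ? ? ? ? ? ? ? ? ?.
set L' := Num.min L _.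
have L'L : L' <= L by rewrite ge_min lexx.
have L'p : L' <= excess u - a p by rewrite ge_min lexx orbT.
have L'E : L' = L \/ L' = excess u - a p.
  by rewrite /L'; case: leP => _; [left|right].
have qQ : b q < a q by case/andP: qsQ.
split=> //.
- by apply: perm_trans perm_u; rewrite -cats1 -catA.
- move=> x; rewrite mem_rcons inE => /predU1P[->|xu] xQ y yqs.
    by move: pP; rewrite leNgt xQ.
  exact: (done_u x).
- by move=> s1 x s2 E; case: (rcons_split E) => [[u2 /low_u]|[-> ->]] //; lra.
- move=> s1 x s2 eq_u; case: (rcons_split eq_u) => [[u2 uE]|[-> ->]].
    have := high_u _ _ _ uE; case: phase => [?|[_ /(_ _ _ _ uE)]]; rewrite /K;
    by case: L'E => E; lra.
  by rewrite /K; case: L'E => E; lra.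
- right; case: L'E => E.
    (* With [u] empty and [L = 0], keeping the minimum forces [a p = 0], so [p] attains it as
       well. *)
    case: legit => [[uE LE]|]; last by rewrite E.
    have -> : L' = excess u - a p.
      by move: L'p; rewrite uE excess_nil; lra.
    apply: (first_stage_prefix perm_u) => //; first by rewrite uE.
  have [uP|uP] := boolP (all (fun x => a x <= b x) u).
    by rewrite E; apply: (first_stage_prefix perm_u).
  case: phase => [?|[]]; last by rewrite (negPf uP).
  case: legit => [[uE _]|]; first by rewrite uE in uP.
  by rewrite (_ : L' = L); lra.
- case: phase => [?|[uP hu]]; first by left; rewrite excess_rcons; lra.
  right; rewrite all_rcons pP uP; split=> // s1 x s2; rewrite excess_rcons.
  by move=> E; case: (rcons_split E) => [[u2 /hu]|[-> ->]]; lra.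
- move=> q2 qs' [<- _]; rewrite excess_rcons; case: L'E; lra.
Qed.

Lemma mix_invP u ps qs L : mix_inv u ps qs L ->
  exists u' ps' qs' L',
    [/\ u ++ mix ps qs (excess u) L = u' ++ ps' ++ qs',
        ps' = [::] \/ qs' = [::] & mix_inv u' ps' qs' L'].
Proof.
have [k] := ubnP (size ps + size qs)%N.
elim: k u ps qs L => // k IH u [|p ps] qs L sz inv.
  by exists u, [::], qs, L; rewrite mix0s; split=> //; left.
case: qs sz inv => [|q qs] sz inv.
  by exists u, (p :: ps), [::], L; rewrite mixs0 cats0; split=> //; right.
rewrite mix_cons; case: leP => [/(mix_inv_q inv)|/(mix_inv_p inv)] /IH[].
- by move: sz => /=; rewrite addnS.
- move=> u' [ps' [qs' [L' [E ? ?]]]]; exists u', ps', qs', L'; split=> //.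
  by rewrite -E -cats1 -catA -excess_rcons cats1.
- by move: sz => /=; rewrite addSn.
- move=> u' [ps' [qs' [L' [E ? ?]]]]; exists u', ps', qs', L'; split=> //.
  by rewrite -E -cats1 -catA -excess_rcons cats1.
Qed.

(** A job of [u] has low at least [L], which [mix_legit] covers. A job of the final stretch is
    bounded by one of the two stage bounds, except when the tail comes from [ps] and [u] is in the
    first phase: then the excess is at least [L + M] from there on, and the low is again at least
    [L]. *)
Lemma mix_inv_optimal u ps qs L s1 x s2 :
    mix_inv u ps qs L -> ps = [::] \/ qs = [::] ->
    u ++ ps ++ qs = s1 ++ x :: s2 ->
  total - (excess s1 - a x) <= LB.
Proof.
case=> perm_u psP qsQ ps_s qs_s done_u low_u high_u legit phase head tail E.
have [[u2 uE]|[v1 s1E {}E]] := cat_split E.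
  have := low_u _ _ _ uE; case: legit => [[u0]|]; last by lra.
  by move: uE; rewrite u0; case: (s1).
have := a_le x; have := a_ge0 x => ? ?.
case: tail => tailE; last first.
  move: perm_u ps_s psP E; rewrite tailE cats0 => perm_u ps_s psP E.
  move: perm_u ps_s psP; rewrite E pairwise_cat all_cat /=.
  move=> perm_u /and3P[_ _ /andP[x_min _]] /and3P[v1P xP _].
  have := excess_ge0 v1P => v1_ge0.
  have [uP|uP] := boolP (all (fun x => a x <= b x) u).
    rewrite s1E; apply: (@first_stage_prefix _ _ s2 [::]) => //.
      by rewrite cats0 -catA.
    by rewrite all_cat uP.
  case: phase => [?|[]]; last by rewrite (negPf uP).
  case: legit => [[u0 _]|]; first by rewrite u0 in uP.
  by rewrite s1E excess_cat; lra.
move: perm_u qs_s qsQ E; rewrite tailE cat0s => perm_u qs_s qsQ E.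
move: qs_s; rewrite E pairwise_cat => /and3P[/allrelP x_max _ /= /andP[x_min _]].
rewrite s1E; apply: (second_stage_suffix (q2 := s2)) => //.
- by rewrite -E.
- by move=> y yu yQ; apply: (done_u y) => //; rewrite E mem_cat inE eqxx orbT.
- by apply/allP => y yv; apply: x_max; rewrite ?inE ?eqxx.
- by rewrite -E.
Qed.

(** Once [ps] is exhausted the excess only falls, so later highs are compared with earlier lows.
    Once [qs] is exhausted the excess only grows, so earlier highs are compared with later lows. *)
Lemma mix_inv_window u ps qs L :
    mix_inv u ps qs L -> ps = [::] \/ qs = [::] ->
  (forall s1 x s2 s3 y s4, u ++ ps ++ qs = s1 ++ x :: s2 ->
     u ++ ps ++ qs = s3 ++ y :: s4 -> (size s1 < size s3)%N ->
     excess s1 + b x - (excess s3 - a y) <= K) \/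
  (forall s1 x s2 s3 y s4, u ++ ps ++ qs = s1 ++ x :: s2 ->
     u ++ ps ++ qs = s3 ++ y :: s4 -> (size s1 < size s3)%N ->
     excess s3 + b y - (excess s1 - a x) <= K).
Proof.
case=> perm_u psP qsQ ps_s qs_s done_u low_u high_u legit phase head tail.
case: tail => tailE; [right|left]; rewrite tailE ?cats0 ?cat0s => s1 x s2 s3 y s4 E1 E3 sz;
have := a_le x; have := a_ge0 x; have := a_le y; have := a_ge0 y;
have := b_le x; have := b_ge0 x; have := b_le y; have := b_ge0 y => ? ? ? ? ? ? ? ?.
- have [[u4 u3E]|[v3 s3E qE]] := cat_split E3.
    have [[u2 u1E]|[v1 s1E _]] := cat_split E1; last first.
      by move: sz; rewrite s1E u3E !size_cat -addnA ltnNge leq_addr.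
    have := high_u _ _ _ u3E; have := low_u _ _ _ u1E; lra.
  have [[u2 u1E]|[v1 s1E q1E]] := cat_split E1; last first.
    have [|r v3E] := split_nested (etrans (esym q1E) qE).
      by move: sz; rewrite s1E s3E !size_cat ltn_add2l.
    have : excess (x :: r) <= 0.
      by apply: excess_le0; move: qsQ; rewrite qE v3E !all_cat => /andP[/andP[]].
    rewrite s1E s3E v3E !excess_cat /K; lra.
  have := low_u _ _ _ u1E.
  have : excess s3 + b y <= L + K; last by lra.
  (* [mix_head] bounds the excess after the first job of the tail, and from there the excess does
     not grow; [b y < a y <= M] accounts for the last term. *)
  rewrite s3E excess_cat; case: v3 s3E qE => [|q v3] s3E qE.
    rewrite excess_nil; have := head _ _ qE; rewrite /K; lra.
  have := head _ _ qE; move: qsQ; rewrite qE /= all_cat /=.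
  move=> /and4P[_ /excess_le0 ? ? _].
  rewrite excess_cons /K; lra.
- have [[u4 u3E]|[v3 s3E pE]] := cat_split E3.
    have [[u2 u1E]|[v1 s1E _]] := cat_split E1; last first.
      by move: sz; rewrite s1E u3E !size_cat -addnA ltnNge leq_addr.
    have := high_u _ _ _ u1E; have := low_u _ _ _ u3E; lra.
  have v3P : all (fun x => a x <= b x) v3.
    by move: psP; rewrite pE all_cat => /andP[].
  have [[u2 u1E]|[v1 s1E p1E]] := cat_split E1; last first.
    have [|r v3E] := split_nested (etrans (esym p1E) pE).
      by move: sz; rewrite s1E s3E !size_cat ltn_add2l.
    move: v3P; rewrite s1E s3E v3E all_cat /= => /and3P[_ _ /excess_ge0].
    rewrite !excess_cat excess_cons /K; lra.
  have := excess_ge0 v3P; have := high_u _ _ _ u1E; rewrite s3E excess_cat.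
  by case: phase => [?|[_ /(_ _ _ _ u1E)]]; rewrite /K; lra.
Qed.

End Mix.

(** The schedule read off from memory is known to agree with the timetable only pointwise. *)
Lemma optimal_ext (R : archiRealFieldType) (n : nat) (I : instance R n)
    (s s' : schedule R n) :
    (forall j, start1 s' j = start1 s j) -> (forall j, start2 s' j = start2 s j) ->
  optimal I s -> optimal I s'.
Proof.
move=> eq1 eq2 [fs s_opt].
have eqC1 j : compl1 I s' j = compl1 I s j by rewrite /compl1 eq1.
have eqC2 j : compl2 I s' j = compl2 I s j by rewrite /compl2 eq2.
case: fs => ? ? m1 m2 st sto; split.
  split=> [j|j|i j|i j|j|t]; rewrite ?eqC1 ?eqC2 ?eq1 ?eq2; auto.
  rewrite /storage_used (eq_bigl (fun j => (start1 s j <= t) && (t < compl2 I s j))).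
    exact: sto.
  by move=> j; rewrite eqC2 eq1.
move=> s2 /s_opt; congr (_ <= _); by apply: eq_bigr => j _; rewrite eqC2.
Qed.

(** * Optimality of the interleaved order *)

Section OrderOptimal.

Variables (R : archiRealFieldType) (n : nat) (I : instance R n).

(** The extension by 0 to all naturals is the one of [input], so orders can be sequences of naturals
    and memory cells match directly. *)
Definition time1 (j : nat) : R := oapp (proc1 I) 0 (insub j).
Definition time2 (j : nat) : R := oapp (proc2 I) 0 (insub j).

Lemma time1E (j : 'I_n) : time1 j = proc1 I j.
Proof. by rewrite /time1 valK. Qed.

Lemma time2E (j : 'I_n) : time2 j = proc2 I j.
Proof. by rewrite /time2 valK. Qed.

Lemma time1_ge0 j : 0 <= time1 j.
Proof. by rewrite /time1; case: insub => //= i; apply: proc1_ge0. Qed.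

Lemma time2_ge0 j : 0 <= time2 j.
Proof. by rewrite /time2; case: insub => //= i; apply: proc2_ge0. Qed.

Lemma time1_le j : time1 j <= amax I.
Proof.
rewrite /time1; case: insub => [i|] /=; [exact: le_amax | exact: bigmax_ge_id].
Qed.

Lemma time2_le j : time2 j <= bmax I.
Proof.
rewrite /time2; case: insub => [i|] /=; [exact: le_bmax | exact: bigmax_ge_id].
Qed.

Variables (ps qs : seq nat).
Hypotheses (jobsE : perm_eq (ps ++ qs) (iota 0 n))
  (psP : all (fun x => time1 x <= time2 x) ps)
  (qsQ : all (fun x => time2 x < time1 x) qs)
  (ps_sorted : pairwise (fun x y => time1 x <= time1 y) ps)
  (qs_sorted : pairwise (fun x y => time2 y <= time2 x) qs).
Hypothesis capacity_ge : 3 * amax I + bmax I <= capacity I.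

Definition job_order : seq nat := mix time1 time2 (amax I) ps qs 0 0.
Definition time1_at (i : nat) : R := nth 0 (map time1 job_order) i.
Definition time2_at (i : nat) : R := nth 0 (map time2 job_order) i.

Lemma sum_iota (F : nat -> R) : \sum_(y <- iota 0 n) F y = \sum_(j < n) F j.
Proof. by rewrite -(big_mkord predT F) /index_iota subn0. Qed.

Lemma first_stage_makespan s : feasible I s -> forall x, x \in iota 0 n ->
  time1 x + \sum_(y <- iota 0 n)
    (if time1 y < time1 x then Num.min (time1 y) (time2 y) else time2 y)
  <= makespan I s.
Proof.
move=> fs x; rewrite mem_iota => /= xn; rewrite sum_iota.
have := makespan_ge_first_stage fs (lexx (proc1 I (Ordinal xn))).
rewrite -(time1E (Ordinal xn)) /=; congr (_ + _ <= _).
by apply: eq_bigr => j _; rewrite -!time1E -!time2E.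
Qed.

Lemma second_stage_makespan s : feasible I s -> forall x, x \in iota 0 n ->
  time2 x + \sum_(y <- iota 0 n)
    (if time2 y < time2 x then Num.min (time1 y) (time2 y) else time1 y)
  <= makespan I s.
Proof.
move=> fs x; rewrite mem_iota => /= xn; rewrite sum_iota.
have := makespan_ge_second_stage fs (lexx (proc2 I (Ordinal xn))).
rewrite -(time2E (Ordinal xn)) /=; congr (_ + _ <= _).
by apply: eq_bigr => j _; rewrite -!time1E -!time2E.
Qed.

Lemma order_inv (LB : R) :
    (forall x, x \in iota 0 n -> time1 x + \sum_(y <- iota 0 n)
       (if time1 y < time1 x then Num.min (time1 y) (time2 y) else time2 y) <= LB) ->
    (forall x, x \in iota 0 n -> time2 x + \sum_(y <- iota 0 n)
       (if time2 y < time2 x then Num.min (time1 y) (time2 y) else time1 y) <= LB) ->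
  exists u ps' qs' L, [/\ job_order = u ++ ps' ++ qs', ps' = [::] \/ qs' = [::] &
    mix_inv time1 time2 (amax I) (bmax I) LB (iota 0 n) u ps' qs' L].
Proof.
move=> first second.
have inv : mix_inv time1 time2 (amax I) (bmax I) LB (iota 0 n) [::] ps qs 0.
  by apply: mix_inv0 => //; [exact: time1_ge0 | exact: time2_ge0
    | exact: time1_le | exact: time2_le].
have := @mix_invP _ _ _ _ _ _ _ _ time1_ge0 time2_ge0 time1_le time2_le first _ _ _ _ inv.
by rewrite excess_nil.
Qed.

(** The permutation and window properties do not mention [LB], so they are extracted with a bound
    large enough to satisfy both stage conditions, before any feasible schedule is known. *)
Lemma order_inv0 : exists LB u ps' qs' L, [/\ job_order = u ++ ps' ++ qs',
    ps' = [::] \/ qs' = [::] &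
    mix_inv time1 time2 (amax I) (bmax I) LB (iota 0 n) u ps' qs' L].
Proof.
exists (amax I + bmax I + \sum_(y <- iota 0 n) (time1 y + time2 y)).
have := amax_ge0 I; have := bmax_ge0 I => ? ?.
apply: order_inv => x _.
  have : \sum_(y <- iota 0 n)
    (if time1 y < time1 x then Num.min (time1 y) (time2 y) else time2 y) <=
      \sum_(y <- iota 0 n) (time1 y + time2 y).
    apply: ler_sum => y _; have := time1_ge0 y; have := time2_ge0 y.
    by case: ifP => _; rewrite ?ge_min; lra.
  by have := time1_le x; lra.
have : \sum_(y <- iota 0 n)
  (if time2 y < time2 x then Num.min (time1 y) (time2 y) else time1 y) <=
    \sum_(y <- iota 0 n) (time1 y + time2 y).
  apply: ler_sum => y _; have := time1_ge0 y; have := time2_ge0 y.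
  by case: ifP => _; rewrite ?ge_min; lra.
by have := time2_le x; lra.
Qed.

Lemma order_perm : perm_eq job_order (iota 0 n).
Proof. by have [LB [u [ps' [qs' [L [-> _ []]]]]]] := order_inv0. Qed.

Lemma size_order : size job_order = n.
Proof. by rewrite (perm_size order_perm) size_iota. Qed.

Lemma index_order_lt (j : 'I_n) : (index (j : nat) job_order < n)%N.
Proof.
by rewrite -[X in (_ < X)%N]size_order index_mem (perm_mem order_perm) mem_iota /=.
Qed.

Definition position (j : 'I_n) : 'I_n := Ordinal (index_order_lt j).

Lemma position_inj : injective position.
Proof.
move=> i j /(congr1 val) /= /(congr1 (nth 0%N job_order)).
rewrite !nth_index ?(perm_mem order_perm) ?mem_iota //=; exact: val_inj.
Qed.

Lemma time1_at_position j : time1_at (position j) = proc1 I j.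
Proof.
rewrite /time1_at (nth_map 0%N) ?nth_index ?time1E //.
  by rewrite (perm_mem order_perm) mem_iota /=.
by rewrite size_order.
Qed.

Lemma time2_at_position j : time2_at (position j) = proc2 I j.
Proof.
rewrite /time2_at (nth_map 0%N) ?nth_index ?time2E //.
  by rewrite (perm_mem order_perm) mem_iota /=.
by rewrite size_order.
Qed.

Lemma order_split i : (i < n)%N ->
  job_order = take i job_order ++ nth 0%N job_order i :: drop i.+1 job_order.
Proof. by move=> ilt; rewrite -drop_nth ?cat_take_drop // size_order. Qed.

Lemma excess_order i : (i <= n)%N ->
  excess time1 time2 (take i job_order) = psum time2_at i - psum time1_at i.
Proof.
elim: i => [|i IH] ilt; first by rewrite take0 excess_nil !psum0 subrr.
rewrite (take_nth 0%N) ?size_order // excess_rcons (IH (ltnW ilt)) !psumS.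
rewrite /time1_at /time2_at !(nth_map 0%N) ?size_order //; lra.
Qed.

Lemma high_order i : (i < n)%N -> high time1_at time2_at i =
  excess time1 time2 (take i job_order) + time2 (nth 0%N job_order i).
Proof.
move=> ilt; rewrite excess_order ?(ltnW ilt) // /high.
by rewrite [time2_at i](nth_map 0%N) ?size_order.
Qed.

Lemma low_order i : (i < n)%N -> low time1_at time2_at i =
  excess time1 time2 (take i job_order) - time1 (nth 0%N job_order i).
Proof.
move=> ilt; rewrite excess_order ?(ltnW ilt) // /low.
by rewrite [time1_at i](nth_map 0%N) ?size_order.
Qed.

Lemma window_order (K := 2 * amax I + bmax I) :
  (forall i l, (i < l < n)%N ->
     high time1_at time2_at i - low time1_at time2_at l <= K) \/
  (forall i l, (i <= l < n)%N ->
     high time1_at time2_at l - low time1_at time2_at i <= K).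
Proof.
have [LB [u [ps' [qs' [L [orderE tail inv]]]]]] := order_inv0.
have := mix_inv_window time1_ge0 time2_ge0 time1_le time2_le inv tail; rewrite -orderE.
have size_take_lt i l : (i < l < n)%N ->
    (size (take i job_order) < size (take l job_order))%N.
  by move=> /andP[il ln]; rewrite !size_takel ?size_order // ltnW // (ltn_trans il).
case=> window; [left|right] => i l /andP[il ln].
  have i_n := ltn_trans il ln.
  rewrite high_order ?low_order //.
  by apply: (window _ _ _ _ _ _ (order_split i_n) (order_split ln));
    apply: size_take_lt; rewrite il.
move: il; rewrite leq_eqVlt => /predU1P[->|il].
  rewrite high_order ?low_order // /K; set x := nth _ _ _.
  have := time1_le x; have := time2_le x; have := time1_ge0 x; lra.
have i_n := ltn_trans il ln.
rewrite high_order ?low_order //.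
by apply: (window _ _ _ _ _ _ (order_split i_n) (order_split ln));
    apply: size_take_lt; rewrite il.
Qed.

Lemma time1_at_ge0 i : 0 <= time1_at i.
Proof.
rewrite /time1_at; have [ilt|ile] := ltnP i (size job_order).
  by rewrite (nth_map 0%N) // time1_ge0.
by rewrite nth_default // size_map.
Qed.

Lemma time2_at_ge0 i : 0 <= time2_at i.
Proof.
rewrite /time2_at; have [ilt|ile] := ltnP i (size job_order).
  by rewrite (nth_map 0%N) // time2_ge0.
by rewrite nth_default // size_map.
Qed.

Lemma psum_order : psum time2_at n = \sum_(x <- iota 0 n) time2 x.
Proof.
rewrite -(perm_big _ order_perm) /= (big_nth 0%N) size_order /psum.
apply: eq_big_nat => i /andP[_ ilt].
by rewrite /time2_at (nth_map 0%N) ?size_order.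
Qed.

(** If job [i] opens the last busy period of M2, then [finish2 n] equals the sum of [b] minus
    [low i], which [mix_inv_optimal] bounds when [LB] is the makespan of [s]. *)
Lemma finish2_le_makespan s : feasible I s ->
  finish2 time1_at time2_at n <= makespan I s.
Proof.
move=> fs; case: (posnP n) => [n0|n_gt0].
  by rewrite [X in finish2 _ _ X]n0; apply: bigmax_ge_id.
have [i] := finish2_path time2_at time1_at_ge0 n.-1; rewrite prednK // => ile ->.
have i_n : (i < n)%N by lia.
have first := first_stage_makespan fs.
have [u [ps' [qs' [L [orderE tail inv]]]]] := order_inv first (second_stage_makespan fs).
have := mix_inv_optimal time1_ge0 time1_le first (second_stage_makespan fs) inv tail.
rewrite -orderE => /(_ _ _ _ (order_split i_n)).
have := low_order i_n; rewrite /low -psum_order psumS => <-.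
lra.
Qed.

Lemma optimal_timetable : optimal I (timetable time1_at time2_at position).
Proof.
have := amax_ge0 I; have := bmax_ge0 I; have := capacity_ge => ? ? ?.
split.
  apply: (feasible_timetable time1_at_ge0 time2_at_ge0 position_inj
    time1_at_position time2_at_position _ window_order); lra.
move=> s /finish2_le_makespan; apply: le_trans.
exact: (makespan_timetable time1_at time2_at_ge0 time2_at_position).
Qed.

End OrderOptimal.

(** * Merge sort *)

Section MergePass.

Variables (R : archiRealFieldType) (key : nat -> R).

Definition le_key : rel nat := fun x y => key x <= key y.

Lemma le_key_total : total le_key.
Proof. by move=> x y; apply: le_total. Qed.

Lemma le_key_trans : transitive le_key.
Proof. by move=> y x z; apply: le_trans. Qed.

(** [f] is fuel; for positive [w] the size of [s] is enough. *)
Fixpoint merge_pass (f w : nat) (s : seq nat) : seq nat :=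
  if f is f'.+1 then
    merge le_key (take w s) (take w (drop w s)) ++
    merge_pass f' w (drop (w + w) s)
  else [::].

Definition runs_sorted (w : nat) (s : seq nat) : Prop :=
  forall c, sorted le_key (take w (drop (c * w) s)).

Lemma merge_pass_nil f w : merge_pass f w [::] = [::].
Proof. by elim: f. Qed.

Lemma perm_merge_pass f w s : (0 < w)%N -> (size s <= f)%N ->
  perm_eq (merge_pass f w s) s.
Proof.
move=> w0; elim: f s => [|f IH] s sf; first by move: sf; case: s.
have [->|s0] := eqVneq s [::]; first by rewrite merge_pass_nil.
have {}IH := IH (drop (w + w) s) _.
rewrite -[X in perm_eq _ X](cat_take_drop w) -[X in _ ++ X](cat_take_drop w) catA.
rewrite /= drop_drop perm_cat ?perm_merge //.
by apply: IH; rewrite size_drop; move: s0; rewrite -size_eq0; lia.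
Qed.

Lemma merge_pass_run f w s c : (0 < w)%N -> (size s <= f)%N ->
  take (w + w) (drop (c * (w + w)) (merge_pass f w s)) =
  merge le_key (take w (drop (c * (w + w)) s)) (take w (drop (c * (w + w) + w) s)).
Proof.
move=> w0; elim: f s c => [|f IH] s c sf.
  by move: sf; case: s => // _; rewrite merge_pass_nil !drop_oversize.
have [->|s0] := eqVneq s [::]; first by rewrite merge_pass_nil !drop_oversize.
have sf' : (size (drop (w + w) s) <= f)%N.
  by rewrite size_drop; move: s0; rewrite -size_eq0; lia.
rewrite /=; set l := merge _ _ _.
have [sw|sw] := leqP (w + w) (size s); last first.
  have -> : drop (w + w) s = [::] by rewrite drop_oversize // ltnW.
  rewrite merge_pass_nil cats0.
  have sl : size l = size s.
    by rewrite /l size_merge size_cat !size_take_min size_drop; lia.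
  case: c => [|c].
    by rewrite !mul0n !drop0 add0n take_oversize // sl ltnW.
  by rewrite !drop_oversize // ?sl; lia.
have sl : size l = (w + w)%N.
  by rewrite /l size_merge size_cat !size_take_min size_drop; lia.
case: c => [|c].
  by rewrite !mul0n !drop0 add0n take_size_cat.
rewrite mulSn drop_cat sl ltnNge leq_addr /= addKn IH //.
by rewrite !drop_drop; congr (merge _ (take _ (drop _ _)) (take _ (drop _ _))); lia.
Qed.

Lemma runs_sorted_pass f w s : (0 < w)%N -> (size s <= f)%N ->
  runs_sorted w s -> runs_sorted (w + w) (merge_pass f w s).
Proof.
move=> w0 sf ss c; rewrite merge_pass_run //; apply: merge_sorted.
- exact: le_key_total.
(* Run [c] of the result comes from the runs [2c] and [2c + 1] of [s]. *)
- by have := ss (c + c)%N; rewrite (_ : (c + c) * w = c * (w + w))%N //; lia.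
- by have := ss (c + c).+1; rewrite (_ : (c + c).+1 * w = c * (w + w) + w)%N //; lia.
Qed.

(* [t] is the result of the pass over [s], of which [k] entries are known; the
   runs being merged are s[i..mid) and s[j..hi), truncated at the end of s. *)
Record pass_inv (w : nat) (s t : seq nat) (i mid j hi k : nat) : Prop := PassInv {
  pass_i : (i <= mid)%N;
  pass_j : (mid <= j <= hi)%N;
  pass_k : (k + mid = i + j)%N;
  pass_rest : exists2 f, (size s - hi <= f)%N &
    drop k t = merge le_key (take (mid - i) (drop i s)) (take (hi - j) (drop j s)) ++
      merge_pass f w (drop hi s)
}.

(** Both runs are empty at first, so the first iteration opens a pair of runs through
    [pass_reset]. *)
Lemma pass_inv0 w s : pass_inv w s (merge_pass (size s) w s) 0 0 0 0 0.
Proof.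
split=> //; exists (size s); first by rewrite subn0.
by rewrite !take0 !drop0.
Qed.

Lemma pass_reset w s t i mid j hi k : (0 < w)%N ->
    pass_inv w s t i mid j hi k -> (hi <= k < size s)%N ->
  pass_inv w s t hi (hi + w) (hi + w) (hi + w + w) k.
Proof.
move=> w0 [i_mid /andP[mid_j j_hi] kE [f sf tE]] /andP[hi_k ks].
(* The balance [k + mid = i + j] gives [k <= hi]; equality means that both runs are used up. *)
have kE' : k = hi by lia.
split; rewrite ?leq_addr ?leqnn ?kE' //.
case: f sf tE => [|f] sf tE; first by lia.
exists f; first by lia.
rewrite -kE' tE (_ : mid - i = 0)%N 1?(_ : hi - j = 0)%N; [|lia|lia].
rewrite !take0 /= !addKn !drop_drop -addnA kE'; congr (merge _ _ (take _ (drop _ _)) ++ _).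
  lia.
by congr (merge_pass _ _ (drop _ _)); lia.
Qed.

Lemma drop_consE (t r : seq nat) (k y : nat) :
  drop k t = y :: r -> nth 0%N t k = y /\ drop k.+1 t = r.
Proof.
move=> tE; have kt : (k < size t)%N.
  by rewrite ltnNge; apply/negP => /drop_oversize; rewrite tE.
by move: tE; rewrite (drop_nth 0%N) // => -[].
Qed.

(** The condition decides which run provides the head of the merge, ties going to the first run.
    Index [i] stays inside [s] because [mid <= j] implies [i <= k], while [j] may pass the end of
    [s] when the second run is truncated. *)
Lemma pass_step w s t i mid j hi k :
    pass_inv w s t i mid j hi k -> (k < size s)%N -> (k < hi)%N ->
  if (i < mid)%N && ~~ ((j < hi)%N && (j < size s)%N &&
      (key (nth 0%N s j) < key (nth 0%N s i)))
  then nth 0%N t k = nth 0%N s i /\ pass_inv w s t i.+1 mid j hi k.+1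
  else [/\ nth 0%N t k = nth 0%N s j, (j < size s)%N &
         pass_inv w s t i mid j.+1 hi k.+1].
Proof.
case=> i_mid /andP[mid_j j_hi] kE [f sf tE] ks khi.
have takeE i' mid' : (i' < mid')%N -> (i' < size s)%N ->
    take (mid' - i') (drop i' s) =
    nth 0%N s i' :: take (mid' - i'.+1) (drop i'.+1 s).
  by move=> i'mid' i's; rewrite (drop_nth 0%N) // subnS -(prednK (n := mid' - i')) // subn_gt0.
have [i_lt|i_ge] := ltnP i mid; last first.
  have iE : i = mid by lia.
  move: tE; rewrite iE subnn take0 /= takeE; [|lia|lia].
  move=> /drop_consE[-> tE]; split=> //; first by lia.
  by split; rewrite ?leqnn //; [lia|lia|exists f; rewrite ?subnn ?take0].
have i_s : (i < size s)%N by lia.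
have [j_lt|j_ge] := boolP ((j < hi) && (j < size s))%N; last first.
  have tE' : take (hi - j) (drop j s) = [::].
    move: j_ge; rewrite negb_and -!leqNgt => /orP[j_ge|j_ge].
      by rewrite (_ : hi - j = 0)%N ?take0 //; lia.
    by rewrite drop_oversize.
  move: tE; rewrite tE' takeE // /= => /drop_consE[-> tE]; split=> //.
  split; rewrite // ?mid_j //; first by lia.
  exists f => //; rewrite tE tE'; congr (_ ++ _); by case: take.
move: tE; case/andP: j_lt => j_hi' j_s; rewrite (takeE i) // (takeE j) //= {1}/le_key.
rewrite -leNgt; case: ifP => _ /= /drop_consE[-> tE]; split=> //.
  by split; rewrite ?mid_j //; [lia|exists f; rewrite // tE (takeE j)].
by split; rewrite ?(leqW mid_j) //; [lia|exists f; rewrite // tE (takeE i)].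
Qed.

End MergePass.

Lemma pairwise_partition (T : eqType) (r : rel T) (P : pred T) (s : seq T) :
    pairwise r s -> (forall x y, P x -> ~~ P y -> ~~ r y x) ->
  s = filter P s ++ filter (predC P) s.
Proof.
move=> + sep; elim: s => //= x s IH /andP[/allP x_min /IH {}IH].
have [Px|nPx] /= := boolP (P x); first by rewrite [in LHS]IH.
have noP : filter P s = [::].
  apply/eqP; rewrite -[_ == _]negbK -has_filter; apply/hasPn => y /x_min rxy.
  by apply: contraL rxy => Py; apply: sep.
by rewrite noP /= [in LHS]IH noP.
Qed.

(** * The program *)

Section Runs.

Variable R : archiRealFieldType.
Implicit Types (m : memory R) (p q : program) (Q : memory R -> Prop).

(** A total-correctness triple with a time bound. *)
Definition runs p m (c : nat) Q : Prop :=
  exists t m', [/\ exec p m t m', (t <= c)%N & Q m'].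

Lemma runs_weaken p m c c' Q Q' : (c <= c')%N -> (forall m', Q m' -> Q' m') ->
  runs p m c Q -> runs p m c' Q'.
Proof.
move=> cc' QQ' [t [m' [ex tc Qm']]]; exists t, m'.
by split; [|exact: leq_trans cc'|exact: QQ'].
Qed.

Lemma runs_seq p q m c1 c2 Q :
  runs p m c1 (fun m1 => runs q m1 c2 Q) -> runs (Seq p q) m (c1 + c2) Q.
Proof.
move=> [t1 [m1 [ex1 tc1 [t2 [m2 [ex2 tc2 Qm2]]]]]]; exists (t1 + t2)%N, m2.
by split; [exact: ExecSeq ex1 ex2|exact: leq_add|].
Qed.

(** Weakest preconditions of loop-free programs; loops are left to [runs_while]. Accordingly the
    cost 1 of a loop in [max_cost] is a dummy value. *)
Fixpoint wp p m Q : Prop :=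
  match p with
  | Skip => Q m
  | Store A e1 e2 => Q (update m A (Num.truncn (eval m e1)) (eval m e2))
  | Seq p1 p2 => wp p1 m (fun m1 => wp p2 m1 Q)
  | If b p1 p2 => if holds m b then wp p1 m Q else wp p2 m Q
  | While _ _ => False
  end.

Fixpoint max_cost p : nat :=
  match p with
  | Skip | While _ _ => 1
  | Store _ e1 e2 => (expr_cost e1 + expr_cost e2).+1
  | Seq p1 p2 => max_cost p1 + max_cost p2
  | If b p1 p2 => (test_cost b + maxn (max_cost p1) (max_cost p2)).+1
  end.

Lemma wp_runs p m Q : wp p m Q -> runs p m (max_cost p) Q.
Proof.
elim: p m Q => [|A e1 e2|p1 IH1 p2 IH2|b p1 IH1 p2 IH2|b p _] m Q //=.
- by move=> Qm; exists 1%N, m; split=> //; apply: ExecSkip.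
- by move=> Qm; eexists; eexists; split; [exact: ExecStore| |exact: Qm].
- move=> /IH1 H; apply: runs_seq; apply: runs_weaken H => // m'; exact: IH2.
case: ifPn => hb; [move=> /IH1|move=> /IH2] => -[t [m' [ex tc Qm']]];
  exists (test_cost b + t).+1, m'.
  by split; [exact: ExecIfTrue|rewrite ltnS leq_add2l leq_max tc|].
by split; [exact: ExecIfFalse|rewrite ltnS leq_add2l leq_max tc orbT|].
Qed.

(** The invariant is indexed by the number of completed rounds and [N] is their exact number, so it
    also proves termination and gives the cost. *)
Lemma runs_while (b : test) p (c N : nat) (inv : nat -> memory R -> Prop) m :
    (forall k m, (k < N)%N -> inv k m -> holds m b /\ runs p m c (inv k.+1)) ->
    (forall m, inv N m -> ~~ holds m b) -> inv 0 m ->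
  runs (While b p) m (N * (test_cost b + c).+1 + (test_cost b).+1) (inv N).
Proof.
move=> step stop inv0.
have loop d k m' : (k + d = N)%N -> inv k m' ->
    runs (While b p) m' (d * (test_cost b + c).+1 + (test_cost b).+1) (inv N).
  elim: d k m' => [|d IH] k m' kN invk.
    rewrite addn0 in kN; rewrite kN in invk.
    exists (test_cost b).+1, m'.
    by split; [apply: ExecWhileFalse; exact: stop|rewrite mul0n|].
  have [|hb [t1 [m1 [ex1 tc1 inv1]]]] := step k m' _ invk; first by lia.
  have [|t2 [m2 [ex2 tc2 inv2]]] := IH k.+1 m1 _ inv1; first by lia.
  exists (test_cost b + t1 + t2).+1, m2.
  by split; [exact: ExecWhileTrue ex1 ex2|rewrite mulSn; lia|].
exact: (loop N 0%N).
Qed.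

End Runs.

(** * Code of the scheduler *)

Definition var (A : nat) : expr := Cell A (Const 0).
Definition set_var (A : nat) (e : expr) : program := Store A (Const 0) e.
Definition incr (A : nat) : program := set_var A (Add (var A) (Const 1)).
Definition less (e1 e2 : expr) : test := Not (Le e2 e1).

Notation "p ;; q" := (Seq p q) (at level 60, right associativity).

(* Arrays of the program: 0 to 4 are those of [input] and [output], 5 holds the
   sorting keys, 6 the sorted jobs, 7 the merged runs and later the final order.
   Scalars: 8 is the loop counter; 9 and 11 point into the two lists being merged
   or mixed, 10 and 12 are the ends of the two runs, 13 is the run width; 14 is
   the number of jobs with a <= b, 15 is amax; 16 and 17 are the [D] and [L] of
   [mix]; 18 and 19 are the completion times of the machines. *)
Definition init_body : program :=
  If (Le (var 15) (Cell 1 (var 8))) (set_var 15 (Cell 1 (var 8))) Skip ;;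
  Store 6 (var 8) (var 8) ;;
  If (Le (Cell 1 (var 8)) (Cell 2 (var 8)))
    (Store 5 (var 8) (Cell 1 (var 8)) ;; incr 14)
    (Store 5 (var 8) (Defs.Sub (Cell 0 (Const 1)) (Cell 2 (var 8)))) ;;
  incr 8.

Definition init : program := While (less (var 8) (var 0)) init_body.

Definition pass_body : program :=
  If (Le (var 12) (var 8))
    (set_var 9 (var 12) ;; set_var 10 (Add (var 12) (var 13)) ;;
     set_var 11 (var 10) ;; set_var 12 (Add (var 10) (var 13)))
    Skip ;;
  If (And (less (var 9) (var 10))
       (Not (And (And (less (var 11) (var 12)) (less (var 11) (var 0)))
                 (less (Cell 5 (Cell 6 (var 11))) (Cell 5 (Cell 6 (var 9)))))))
    (Store 7 (var 8) (Cell 6 (var 9)) ;; incr 9)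
    (Store 7 (var 8) (Cell 6 (var 11)) ;; incr 11) ;;
  incr 8.

Definition pass_init : program :=
  set_var 8 (Const 0) ;; set_var 9 (Const 0) ;; set_var 10 (Const 0) ;;
  set_var 11 (Const 0) ;; set_var 12 (Const 0).

Definition pass : program := pass_init ;; While (less (var 8) (var 0)) pass_body.

Definition copy_body : program := Store 6 (var 8) (Cell 7 (var 8)) ;; incr 8.

Definition copy : program :=
  set_var 8 (Const 0) ;; While (less (var 8) (var 0)) copy_body.

Definition sort_body : program := pass ;; copy ;; set_var 13 (Add (var 13) (var 13)).

Definition sort_prog : program :=
  set_var 13 (Const 1) ;; While (less (var 13) (var 0)) sort_body.

Definition gain (e : expr) : expr := Defs.Sub (Cell 2 e) (Cell 1 e).

Definition mix_init : program :=
  set_var 8 (Const 0) ;; set_var 9 (Const 0) ;; set_var 11 (var 14).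

Definition mix_choose : program :=
  If (And (less (var 9) (var 14))
       (Not (And (less (var 11) (var 0))
         (Le (Add (var 17) (var 15)) (Add (var 16) (gain (Cell 6 (var 11))))))))
    (If (Le (var 17) (Defs.Sub (var 16) (Cell 1 (Cell 6 (var 9))))) Skip
       (set_var 17 (Defs.Sub (var 16) (Cell 1 (Cell 6 (var 9))))) ;;
     Store 7 (var 8) (Cell 6 (var 9)) ;; incr 9)
    (Store 7 (var 8) (Cell 6 (var 11)) ;; incr 11).

Definition mix_time : program :=
  set_var 16 (Add (var 16) (gain (Cell 7 (var 8)))) ;;
  set_var 18 (Add (var 18) (Cell 1 (Cell 7 (var 8)))) ;;
  If (Le (var 18) (var 19)) Skip (set_var 19 (var 18)) ;;
  Store 4 (Cell 7 (var 8)) (var 19) ;;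
  set_var 19 (Add (var 19) (Cell 2 (Cell 7 (var 8)))) ;;
  incr 8.

Definition mix_prog : program :=
  mix_init ;; While (less (var 8) (var 0)) (mix_choose ;; mix_time).

(** On entry the counter is [n] and scalar 19 still holds [finish2 n], the initial value of
    [begin1_rev]; from then on it holds starts on M1. *)
Definition back_body : program :=
  set_var 8 (Defs.Sub (var 8) (Const 1)) ;;
  If (Le (Cell 4 (Cell 7 (var 8))) (var 19)) (set_var 19 (Cell 4 (Cell 7 (var 8)))) Skip ;;
  set_var 19 (Defs.Sub (var 19) (Cell 1 (Cell 7 (var 8)))) ;;
  Store 3 (Cell 7 (var 8)) (var 19).

Definition back_prog : program := While (Le (Const 1) (var 8)) back_body.

Definition scheduler : program := init ;; sort_prog ;; mix_prog ;; back_prog.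

(** * Symbolic execution *)

Section Eval.

Variable R : archiRealFieldType.
Implicit Types (m : memory R) (Q : memory R -> Prop).

Lemma truncn_nat k : Num.truncn (k%:R : R) = k.
Proof. exact: natrK. Qed.

Lemma eval_var m A : eval m (var A) = m A 0%N.
Proof. by rewrite /= (truncn_nat 0). Qed.

Lemma eval_const m (k : nat) : eval m (Const k) = k%:R. Proof. by []. Qed.

Lemma eval_cell m A e : eval m (Cell A e) = m A (Num.truncn (eval m e)).
Proof. by []. Qed.

Lemma eval_add m e1 e2 : eval m (Add e1 e2) = eval m e1 + eval m e2.
Proof. by []. Qed.

Lemma eval_sub m e1 e2 : eval m (Defs.Sub e1 e2) = eval m e1 - eval m e2.
Proof. by []. Qed.

Lemma eval_gain m e : eval m (gain e) =
  m 2%N (Num.truncn (eval m e)) - m 1%N (Num.truncn (eval m e)).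
Proof. by []. Qed.

Lemma wp_set m A e Q : wp (set_var A e) m Q = Q (update m A 0 (eval m e)).
Proof. by rewrite /= (truncn_nat 0). Qed.

Lemma wp_store m A e1 e2 Q :
  wp (Store A e1 e2) m Q = Q (update m A (Num.truncn (eval m e1)) (eval m e2)).
Proof. by []. Qed.

Lemma wp_incr m A Q : wp (incr A) m Q = Q (update m A 0 (m A 0%N + 1%N%:R)).
Proof. by rewrite wp_set eval_add eval_var. Qed.

Lemma wp_skip m Q : wp Skip m Q = Q m. Proof. by []. Qed.

Lemma wp_seq m p q Q : wp (Seq p q) m Q = wp p m (fun m1 => wp q m1 Q).
Proof. by []. Qed.

Lemma wp_mono p m P Q : (forall m1, P m1 -> Q m1) -> wp p m P -> wp p m Q.
Proof.
elim: p m P Q => [|A e1 e2|p1 IH1 p2 IH2|b p1 IH1 p2 IH2|b p _] m P Q PQ //=.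
- exact: PQ.
- exact: PQ.
- by apply: IH1 => m1; apply: IH2.
by case: ifP => _; [apply: IH1|apply: IH2].
Qed.

(** An intermediate assertion joins the branches of [p], so that [q] is executed only once. *)
Lemma wp_cut m p q P Q :
  wp p m P -> (forall m1, P m1 -> wp q m1 Q) -> wp (Seq p q) m Q.
Proof. by move=> + PQ; apply: wp_mono. Qed.

Lemma wp_if m b p q Q : wp (If b p q) m Q = if holds m b then wp p m Q else wp q m Q.
Proof. by []. Qed.

Lemma holds_le m e1 e2 : holds m (Le e1 e2) = (eval m e1 <= eval m e2).
Proof. by []. Qed.

Lemma holds_less m e1 e2 : holds m (less e1 e2) = (eval m e1 < eval m e2).
Proof. by rewrite ltNge. Qed.

Lemma holds_not m b : holds m (Not b) = ~~ holds m b. Proof. by []. Qed.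

Lemma holds_and m b1 b2 : holds m (And b1 b2) = holds m b1 && holds m b2.
Proof. by []. Qed.

Lemma updateE m A i x A' i' :
  update m A i x A' i' = if (A' == A) && (i' == i) then x else m A' i'.
Proof. by []. Qed.

End Eval.

Arguments eval : simpl never.
Arguments holds : simpl never.
Arguments wp : simpl never.
Arguments update : simpl never.

Definition wpE := (wp_seq, wp_incr, wp_set, wp_store, wp_skip).
Definition evalE := (eval_var, eval_gain, eval_const, eval_add, eval_sub, eval_cell).
Definition holdsE := (holds_less, holds_le, holds_not, holds_and).

(** Simplification decides the index tests left by [update], which exposes further reads; hence the
    repeated rounds in the proofs below. *)
Ltac execute eqs :=
  rewrite ?(wpE, evalE, holdsE, updateE, truncn_nat, natr1, eqs) /=.

Ltac reads eqs :=
  rewrite ?(evalE, holdsE, updateE, truncn_nat, natr1, eqs) /=.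

(** * Correctness of the scheduler *)

Section Scheduler.

Variables (R : archiRealFieldType) (n : nat) (I : instance R n).

Notation a := (time1 I).
Notation b := (time2 I).

Record inputs (m : memory R) : Prop := Inputs {
  input_size : m 0%N 0%N = n%:R;
  input_capacity : m 0%N 1%N = capacity I;
  input_time1 : forall x, m 1%N x = a x;
  input_time2 : forall x, m 2%N x = b x
}.

Definition long2 : pred nat := fun x => a x <= b x.

(* By the capacity bound, [capacity I - b x] exceeds amax for every job of the
   second list, so one sort produces Johnson's order. *)
Definition key (x : nat) : R := if long2 x then a x else capacity I - b x.

Fixpoint max_time1 (k : nat) : R :=
  if k is k'.+1 then Num.max (max_time1 k') (a k') else 0.

Lemma max_time1E : max_time1 n = amax I.
Proof.
have max_time1_le k : max_time1 k <= amax I.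
  by elim: k => [|k IH] /=; [exact: amax_ge0|rewrite ge_max IH time1_le].
apply/eqP; rewrite eq_le max_time1_le /=.
have le_max_time1 x k : (x < k)%N -> a x <= max_time1 k.
  elim: k => // k IH; rewrite ltnS leq_eqVlt /= le_max => /predU1P[->|/IH ->] //.
  by rewrite lexx orbT.
have ge0 k : 0 <= max_time1 k by elim: k => //= k IH; rewrite le_max IH.
by apply: bigmax_le => // j _; rewrite -time1E; apply: le_max_time1.
Qed.

Record init_inv (k : nat) (m : memory R) : Prop := InitInv {
  init_inputs : inputs m;
  init_k : m 8%N 0%N = k%:R;
  init_max : m 15%N 0%N = max_time1 k;
  init_count : m 14%N 0%N = (count long2 (iota 0 k))%:R;
  init_key : forall x, (x < k)%N -> m 5%N x = key x;
  init_order : forall x, (x < k)%N -> m 6%N x = x%:R;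
  init_zero : [/\ m 16%N 0%N = 0, m 17%N 0%N = 0, m 18%N 0%N = 0 & m 19%N 0%N = 0]
}.

Lemma init_step k m : (k < n)%N -> init_inv k m ->
  holds m (less (var 8) (var 0)) /\ runs init_body m (max_cost init_body) (init_inv k.+1).
Proof.
move=> kn [[in_n in_c in_1 in_2] kE maxE countE keyE orderE zeroE].
split; first by rewrite !holdsE !evalE kE in_n ltr_nat.
apply: wp_runs; rewrite /init_body.
apply: (@wp_cut _ _ _ _ (fun m1 => (forall A i, A != 15%N -> m1 A i = m A i) /\
    m1 15%N 0%N = max_time1 k.+1)).
  rewrite wp_if; execute (in_1, kE); rewrite maxE; case: leP => _; execute in_1.
  - by split=> [A i /negPf A15|]; execute in_1; rewrite ?A15.
  - by split.
move=> m1 [m1E max1].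
have E0 := m1E 0%N _ isT; have E1 := m1E 1%N _ isT; have E2 := m1E 2%N _ isT.
have E5 := m1E 5%N _ isT; have E6 := m1E 6%N _ isT; have E8 := m1E 8%N _ isT.
have E14 := m1E 14%N _ isT.
have zero1 : [/\ m1 16%N 0%N = 0, m1 17%N 0%N = 0, m1 18%N 0%N = 0 & m1 19%N 0%N = 0].
  by rewrite !m1E.
have countS : count long2 (iota 0 k.+1) = (count long2 (iota 0 k) + long2 k)%N.
  by rewrite -(addn1 k) iotaD count_cat /= addn0.
have keyE' v x : (x < k.+1)%N -> v = key k -> (if x == k then v else m 5%N x) = key x.
  rewrite ltnS leq_eqVlt; case: eqVneq => [->|_] //= xk _; exact: keyE.
have orderE' x : (x < k.+1)%N -> (if x == k then k%:R else m 6%N x) = x%:R.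
  rewrite ltnS leq_eqVlt; case: eqVneq => [->|_] //= xk; exact: orderE.
rewrite wp_seq wp_store wp_seq wp_if.
do 4! execute (E8, kE, E1, E2, in_1, in_2).
case: ifP => lng; do 4! execute (E8, kE, E1, E2, E14, in_1, in_2).
- split; first (by split; [|..] => *; execute (E0, E1, E2)).
  + by execute E0.
  + by execute max1.
  + by rewrite countS /long2 lng addn1; execute (E14, countE).
  + by move=> x xk; execute E5; apply: keyE' => //; rewrite /key /long2 lng.
  + by move=> x xk; execute E6; apply: orderE'.
  + by execute E0.
- split; first (by split; [|..] => *; execute (E0, E1, E2)).
  + by execute E0.
  + by execute max1.
  + by rewrite countS /long2 lng addn0; execute (E14, countE).
  + move=> x xk; execute E5; apply: keyE' => //.
    by rewrite /key /long2 lng E0 in_c.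
  + by move=> x xk; execute E6; apply: orderE'.
  + by execute E0.
Qed.

Definition loop_cost (body : program) : nat :=
  (n * (test_cost (less (var 8) (var 0)) + max_cost body).+1 +
    (test_cost (less (var 8) (var 0))).+1)%N.

Lemma init_runs : runs init (input I) (loop_cost init_body) (init_inv n).
Proof.
apply: runs_while => [k m1|m1|].
- exact: init_step.
- by case=> [[in_n _ _ _] kE _ _ _ _ _]; rewrite holdsE !evalE kE in_n ltxx.
- by split.
Qed.

Record prepared (m : memory R) : Prop := Prepared {
  prepared_inputs : inputs m;
  prepared_key : forall x, (x < n)%N -> m 5%N x = key x;
  prepared_count : m 14%N 0%N = (count long2 (iota 0 n))%:R;
  prepared_max : m 15%N 0%N = amax I;
  prepared_zero : [/\ m 16%N 0%N = 0, m 17%N 0%N = 0, m 18%N 0%N = 0 & m 19%N 0%N = 0]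
}.

Lemma init_prepared m : init_inv n m -> prepared m.
Proof. by case=> ? _ maxE ? ? _ ?; split=> //; rewrite maxE max_time1E. Qed.

(** Sorting writes only to arrays 6 to 13, so it preserves everything that later phases rely on. *)
Lemma prepared_update m A i x : (5 < A < 14)%N -> prepared m -> prepared (update m A i x).
Proof.
move=> /andP[A5 A14].
have neq B : (B < 6)%N || (13 < B)%N -> (B == A) = false.
  by move=> B6; apply/negbTE; apply: contraTneq B6 => ->; lia.
case=> [[in_n in_c in_1 in_2] keyE countE maxE [z1 z2 z3 z4]].
split; first (split=> [||y|y]); last split; try (move=> y yn);
  by rewrite updateE neq //=; auto.
Qed.

Definition holds_seq (m : memory R) (A k : nat) (s : seq nat) : Prop :=
  forall x, (x < k)%N -> m A x = (nth 0%N s x)%:R.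

Record passing (w : nat) (s t : seq nat) (k : nat) (m : memory R) : Prop := Passing {
  passing_prepared : prepared m;
  passing_w : m 13%N 0%N = w%:R;
  passing_k : m 8%N 0%N = k%:R;
  passing_src : holds_seq m 6 n s;
  passing_dst : holds_seq m 7 k t;
  passing_inv : exists i mid j hi,
    [/\ m 9%N 0%N = i%:R, m 10%N 0%N = mid%:R, m 11%N 0%N = j%:R,
        m 12%N 0%N = hi%:R & pass_inv key w s t i mid j hi k]
}.

Lemma pass_body_step w s t k m : (0 < w)%N -> perm_eq s (iota 0 n) -> (k < n)%N ->
  passing w s t k m ->
  holds m (less (var 8) (var 0)) /\
  runs pass_body m (max_cost pass_body) (passing w s t k.+1).
Proof.
move=> w0 perm_s kn [prep wE kE src dst [i [mid [j [hi [iE midE jE hiE inv]]]]]].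
have size_s : size s = n by rewrite (perm_size perm_s) size_iota.
have s_lt x : (x < n)%N -> (nth 0%N s x < n)%N.
  move=> xn; have : nth 0%N s x \in iota 0 n.
    by rewrite -(perm_mem perm_s) mem_nth ?size_s.
  by rewrite mem_iota.
have [[in_n _ _ _] _ _ _ _] := prep.
split; first by rewrite !holdsE !evalE kE in_n ltr_nat.
apply: wp_runs; rewrite /pass_body.
apply: (@wp_cut _ _ _ _ (fun m1 => [/\ prepared m1, m1 13%N 0%N = w%:R,
  m1 8%N 0%N = k%:R, holds_seq m1 6 n s & holds_seq m1 7 k t /\
  exists i mid j hi, [/\ m1 9%N 0%N = i%:R, m1 10%N 0%N = mid%:R, m1 11%N 0%N = j%:R,
        m1 12%N 0%N = hi%:R & (k < hi)%N /\ pass_inv key w s t i mid j hi k]])).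
  rewrite wp_if holdsE !evalE hiE kE ler_nat; case: leqP => hik.
    do 5! execute (hiE, wE, =^~ natrD).
    split; rewrite ?updateE //; first by do 4! apply: prepared_update => //.
    split=> //; exists hi, (hi + w)%N, (hi + w)%N, (hi + w + w)%N.
    have [|r1 r2 r3 r4] := pass_reset w0 inv; first by rewrite size_s hik.
    by split; rewrite ?updateE //=; split; [lia|split].
  by rewrite wp_skip; split=> //; split=> //; exists i, mid, j, hi.
move=> m1 [{}prep {}wE {}kE {}src [{}dst]] {i mid j hi iE midE jE hiE inv}.
case=> [i [mid [j [hi [iE midE jE hiE [k_hi inv]]]]]].
have [[{}in_n in_c in_1 in_2] keyE _ _ _] := prep.
have i_n : (i < n)%N by case: inv => _ /andP[? ?] ? _; lia.
have := pass_step inv; rewrite size_s => /(_ kn k_hi).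
set test := (X in if X then _ else _) => step.
rewrite wp_seq wp_if; set guard := holds m1 _.
have -> : guard = test.
  rewrite /guard /test !holdsE !evalE iE midE jE hiE in_n !ltr_nat !truncn_nat.
  (* For [j >= n] the cells read are unconstrained, but the conjunction is false anyway. *)
  case: (ltnP j n) => [j_n|_]; rewrite ?andbF //.
  by rewrite !src // !truncn_nat !keyE ?s_lt.
have dstS v x : nth 0%N t k = v -> (x < k.+1)%N ->
    (if x == k then v%:R else m1 7%N x) = (nth 0%N t x)%:R.
  by move=> <-; rewrite ltnS leq_eqVlt; case: eqVneq => [->|_] //= ?; apply: dst.
case: ifP step => _ [tE].
  move=> inv'; do 4! execute (kE, iE, src i i_n).
  split; rewrite ?updateE //=; first by do 3! apply: prepared_update => //.
    by move=> x xk; rewrite !updateE /=; apply: dstS.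
  by exists i.+1, mid, j, hi.
move=> j_n inv'; do 4! execute (kE, jE, src j j_n).
split; rewrite ?updateE //=; first by do 3! apply: prepared_update => //.
  by move=> x xk; rewrite !updateE /=; apply: dstS.
by exists i, mid, j.+1, hi.
Qed.

Lemma pass_runs w s m : (0 < w)%N -> perm_eq s (iota 0 n) ->
    prepared m -> m 13%N 0%N = w%:R -> holds_seq m 6 n s ->
  runs pass m (max_cost pass_init + loop_cost pass_body)
    (passing w s (merge_pass key n w s) n).
Proof.
move=> w0 perm_s prep wE src; apply/runs_seq/wp_runs.
have size_s : size s = n by rewrite (perm_size perm_s) size_iota.
rewrite /pass_init; do 5! execute wE.
apply: runs_while => [k m1||].
- exact: pass_body_step.
- by move=> m1 [[[in_n _ _ _] _ _ _ _] _ kE _ _ _]; rewrite holdsE !evalE kE in_n ltxx.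
split; rewrite ?updateE //=; first by do 5! apply: prepared_update => //.
exists 0%N, 0%N, 0%N, 0%N; split; rewrite ?updateE //=.
by have := pass_inv0 key w s; rewrite size_s.
Qed.

Record copying (w : nat) (t : seq nat) (k : nat) (m : memory R) : Prop := Copying {
  copying_prepared : prepared m;
  copying_w : m 13%N 0%N = w%:R;
  copying_k : m 8%N 0%N = k%:R;
  copying_src : holds_seq m 7 n t;
  copying_dst : holds_seq m 6 k t
}.

Lemma copy_runs w t m :
    prepared m -> m 13%N 0%N = w%:R -> holds_seq m 7 n t ->
  runs copy m (max_cost (set_var 8 (Const 0)) + loop_cost copy_body)
    (copying w t n).
Proof.
move=> prep wE src; apply/runs_seq/wp_runs; execute wE.
apply: runs_while => [k m1 kn [{}prep {}wE kE {}src dst]||].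
- have [[in_n _ _ _] _ _ _ _] := prep.
  split; first by rewrite !holdsE !evalE kE in_n ltr_nat.
  apply: wp_runs; rewrite /copy_body; do 3! execute (kE, src k kn).
  split; rewrite ?updateE //=; first by do 2! apply: prepared_update => //.
  move=> x; rewrite !updateE ltnS leq_eqVlt /=; case: eqVneq => [->|_] //= ?; exact: dst.
- by move=> m1 [[[in_n _ _ _] _ _ _ _] _ kE _ _]; rewrite holdsE !evalE kE in_n ltxx.
by split; rewrite ?updateE //=; apply: prepared_update.
Qed.

Record sorting (w : nat) (m : memory R) : Prop := Sorting {
  sorting_prepared : prepared m;
  sorting_w : m 13%N 0%N = w%:R;
  sorting_seq : exists s, [/\ perm_eq s (iota 0 n), runs_sorted key w s & holds_seq m 6 n s]
}.

Definition sort_body_cost : nat :=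
  (max_cost pass_init + loop_cost pass_body +
    (max_cost (set_var 8 (Const 0)) + loop_cost copy_body +
      max_cost (set_var 13 (Add (var 13) (var 13)))))%N.

Lemma sort_body_runs w m : (0 < w)%N -> sorting w m ->
  runs sort_body m sort_body_cost (sorting (w + w)).
Proof.
move=> w0 [prep wE [s [perm_s sorted_s src]]].
have size_s : size s = n by rewrite (perm_size perm_s) size_iota.
apply: runs_seq; apply: runs_weaken (pass_runs w0 perm_s prep wE src) => // m1.
move=> [{}prep {}wE _ _ dst _].
apply: runs_seq; apply: runs_weaken (copy_runs prep wE dst) => // m2.
move=> [{}prep {}wE _ _ {}src]; apply: wp_runs; execute wE.
split; [exact: prepared_update|by rewrite updateE /= -natrD|].
exists (merge_pass key n w s); split=> //.
- by apply: perm_trans perm_s; apply: perm_merge_pass; rewrite ?size_s.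
- by apply: runs_sorted_pass; rewrite ?size_s.
Qed.

Lemma sort_runs m : init_inv n m ->
  runs sort_prog m (max_cost (set_var 13 (Const 1)) +
    (up_log 2 n * (test_cost (less (var 13) (var 0)) + sort_body_cost).+1 +
    (test_cost (less (var 13) (var 0))).+1)) (sorting (2 ^ up_log 2 n)).
Proof.
move=> inv; have prep := init_prepared inv.
apply/runs_seq/wp_runs; execute (init_k inv).
apply: (@runs_while _ _ _ _ _ (fun r => sorting (2 ^ r))) => [r m1 rn||].
- move=> sort1; split.
    have [[[in_n _ _ _] _ _ _ _] wE _] := sort1.
    rewrite holdsE !evalE wE in_n ltr_nat ltnNge; apply: contraTN rn => nr.
    by rewrite -leqNgt; apply: up_log_min.
  by rewrite expnS mul2n -addnn; apply: sort_body_runs; rewrite ?expn_gt0.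
- move=> m1 [[[in_n _ _ _] _ _ _ _] wE _].
  by rewrite holdsE !evalE wE in_n ltr_nat -leqNgt; apply: up_logP.
split; rewrite ?updateE //=; first exact: prepared_update.
exists (iota 0 n); split=> //.
  move=> c; case: (drop _ _) => [|x l] //=; by rewrite take0.
by move=> x xn; rewrite updateE /= (init_order inv) // nth_iota.
Qed.

Lemma sorted_seq m : sorting (2 ^ up_log 2 n) m ->
  exists s, [/\ perm_eq s (iota 0 n), sorted (le_key key) s & holds_seq m 6 n s].
Proof.
case=> _ _ [s [perm_s sorted_s src]]; exists s; split=> //.
have := sorted_s 0%N; rewrite mul0n drop0 take_oversize //.
by rewrite (perm_size perm_s) size_iota up_logP.
Qed.

(** One loop iteration unfolds [mix] once, with both lists stored in [s] and separated at [c0]. When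
    a list is exhausted, [mix] ignores [D] and [L], so updating them preserves the equation. *)
Lemma mix_step (s t : seq nat) (c0 i j k : nat) (D L : R) :
    (c0 <= size s)%N -> (i <= c0)%N -> (c0 <= j <= size s)%N -> (k + c0 = i + j)%N ->
    (k < size s)%N ->
    drop k t = mix a b (amax I) (drop i (take c0 s)) (drop j s) D L ->
  if (i < c0)%N && ~~ ((j < size s)%N &&
      (L + amax I <= D + (b (nth 0%N s j) - a (nth 0%N s j))))
  then let x := nth 0%N s i in nth 0%N t k = x /\
    drop k.+1 t = mix a b (amax I) (drop i.+1 (take c0 s)) (drop j s)
      (D + (b x - a x)) (if L <= D - a x then L else D - a x)
  else let x := nth 0%N s j in [/\ nth 0%N t k = x, (j < size s)%N &
    drop k.+1 t = mix a b (amax I) (drop i (take c0 s)) (drop j.+1 s)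
      (D + (b x - a x)) L].
Proof.
move=> cs ic /andP[cj js] kE ks tE.
have [i_lt|i_ge] /= := ltnP i c0; last first.
  have jk : j = k by lia.
  have ps0 : drop i (take c0 s) = [::] by rewrite drop_oversize // size_takel.
  move: tE; rewrite ps0 !mix0s jk (drop_nth 0%N ks) => /drop_consE[-> ->].
  by split.
have psE : drop i (take c0 s) = nth 0%N s i :: drop i.+1 (take c0 s).
  have i_take : (i < size (take c0 s))%N by rewrite size_takel.
  by rewrite (drop_nth 0%N i_take) nth_take //.
have [j_lt|j_ge] /= := ltnP j (size s); last first.
  have qs0 : drop j s = [::] by rewrite drop_oversize.
  by move: tE; rewrite psE qs0 !mixs0 => /drop_consE[-> ->].
move: tE; rewrite psE (drop_nth 0%N j_lt) mix_cons.
case: ifP => _ /= /drop_consE[-> ->]; split=> //.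
congr (mix _ _ _ _ _ _ _); by case: leP.
Qed.

Hypothesis capacity_ge : 3 * amax I + bmax I <= capacity I.

Let c := count long2 (iota 0 n).

Lemma sorted_split s : perm_eq s (iota 0 n) -> sorted (le_key key) s ->
  [/\ perm_eq (take c s ++ drop c s) (iota 0 n),
      all (fun x => a x <= b x) (take c s),
      all (fun x => b x < a x) (drop c s),
      pairwise (fun x y => a x <= a y) (take c s) &
      pairwise (fun x y => b y <= b x) (drop c s)].
Proof.
move=> perm_s; rewrite sorted_pairwise; last exact: le_key_trans.
move=> sorted_s; have sE : s = filter long2 s ++ filter (predC long2) s.
  apply: pairwise_partition sorted_s _ => x y lx ly.
  rewrite /le_key /key lx (negPf ly) -ltNge.
  (* A job of the second list has [0 <= b y < a y], so amax is positive and the key of [y] is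
     strictly above amax. *)
  have := capacity_ge; have := time1_le I x; have := time1_le I y.
  have := time2_le I y; have := time2_ge0 I y.
  by move: ly; rewrite /long2 -ltNge; lra.
have cE : c = size (filter long2 s).
  by rewrite size_filter (permP perm_s).
have psE : take c s = filter long2 s by rewrite [X in take _ X]sE cE take_size_cat.
have qsE : drop c s = filter (predC long2) s by rewrite [X in drop _ X]sE cE drop_size_cat.
split; first by rewrite cat_take_drop.
- by rewrite psE filter_all.
- by rewrite qsE; apply/allP => x; rewrite mem_filter /= /long2 -ltNge => /andP[].
- rewrite psE; apply: sub_in_pairwise (filter_all long2 s) (pairwise_filter _ sorted_s).
  by move=> x y; rewrite !unfold_in => lx ly; rewrite /le_key /key /long2 lx ly.
- rewrite qsE.
  apply: sub_in_pairwise (filter_all (predC long2) s) (pairwise_filter _ sorted_s).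
  move=> x y; rewrite !unfold_in /= => /negPf lx /negPf ly; rewrite /le_key /key lx ly.
  by rewrite lerD2l lerN2.
Qed.

(** * The loops that mix the lists and time the jobs *)

Section MixLoop.

Variable s : seq nat.
Hypotheses (perm_s : perm_eq s (iota 0 n)) (sorted_s : sorted (le_key key) s).

Let t := job_order I (take c s) (drop c s).
Let A := time1_at I (take c s) (drop c s).
Let B := time2_at I (take c s) (drop c s).

Let size_s : size s = n. Proof. by rewrite (perm_size perm_s) size_iota. Qed.

Let perm_t : perm_eq t (iota 0 n).
Proof. by have [? ? ? ? ?] := sorted_split perm_s sorted_s; apply: order_perm. Qed.

Let size_t : size t = n. Proof. by rewrite (perm_size perm_t) size_iota. Qed.

Let c_le : (c <= n)%N.
Proof. by rewrite -[X in (_ <= X)%N](size_iota 0 n) count_size. Qed.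

Let A_nth k : (k < n)%N -> A k = a (nth 0%N t k).
Proof. by move=> kn; rewrite /A /time1_at (nth_map 0%N) // size_t. Qed.

Let B_nth k : (k < n)%N -> B k = b (nth 0%N t k).
Proof. by move=> kn; rewrite /B /time2_at (nth_map 0%N) // size_t. Qed.

Let nth_t_eq x k : (x < n)%N -> (k < n)%N -> (nth 0%N t x == nth 0%N t k) = (x == k).
Proof.
by move=> xn kn; rewrite nth_uniq ?size_t // (perm_uniq perm_t) iota_uniq.
Qed.

Record mixing (k : nat) (m : memory R) : Prop := Mixing {
  mixing_inputs : inputs m;
  mixing_count : m 14%N 0%N = c%:R;
  mixing_max : m 15%N 0%N = amax I;
  mixing_src : holds_seq m 6 n s;
  mixing_k : m 8%N 0%N = k%:R;
  mixing_dst : holds_seq m 7 k t;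
  mixing_time1 : m 18%N 0%N = psum A k;
  mixing_time2 : m 19%N 0%N = finish2 A B k;
  mixing_start2 : forall x, (x < k)%N -> m 4%N (nth 0%N t x) = begin2 A B x;
  mixing_inv : exists i j, [/\ m 9%N 0%N = i%:R, m 11%N 0%N = j%:R,
    (i <= c <= j)%N, (j <= n)%N & (k + c = i + j)%N /\
    drop k t = mix a b (amax I) (drop i (take c s)) (drop j s) (m 16%N 0%N) (m 17%N 0%N)]
}.

(** [mix_choose] leaves the update of the excess to [mix_time], so the new excess is spelled out.
    The definition is applied at [k.+1], whose predecessor is the position just filled. *)
Definition choosing (k : nat) (m m1 : memory R) : Prop :=
  exists i j, [/\ m1 9%N 0%N = i%:R, m1 11%N 0%N = j%:R,
    (i <= c <= j)%N, (j <= n)%N & (k + c = i + j)%N /\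
    drop k t = mix a b (amax I) (drop i (take c s)) (drop j s)
      (m 16%N 0%N + (b (nth 0%N t k.-1) - a (nth 0%N t k.-1))) (m1 17%N 0%N)].

Lemma mix_body_step k m : (k < n)%N -> mixing k m ->
  holds m (less (var 8) (var 0)) /\
  runs (mix_choose ;; mix_time) m (max_cost (mix_choose ;; mix_time)) (mixing k.+1).
Proof.
move=> kn [[in_n in_c in_1 in_2] countE maxE src kE dst t1E t2E S2E].
move=> [i [j [iE jE /andP[i_c c_j] j_n [kc tE]]]].
split; first by rewrite !holdsE !evalE kE in_n ltr_nat.
have s_lt x : (x < n)%N -> (nth 0%N s x < n)%N.
  move=> xn; have : nth 0%N s x \in iota 0 n.
    by rewrite -(perm_mem perm_s) mem_nth ?size_s.
  by rewrite mem_iota.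
apply: wp_runs.
apply: (@wp_cut _ _ _ _ (fun m1 =>
  [/\ forall A' x, A' \notin [:: 7%N; 9%N; 11%N; 17%N] -> m1 A' x = m A' x,
      holds_seq m1 7 k.+1 t &
      choosing k.+1 m m1])).
  have dstS v x : nth 0%N t k = v -> (x < k.+1)%N ->
      (if x == k then v%:R else m 7%N x) = (nth 0%N t x)%:R.
    by move=> <-; rewrite ltnS leq_eqVlt; case: eqVneq => [->|_] //= ?; apply: dst.
  have := mix_step _ i_c _ kc _ tE; rewrite size_s c_j j_n => /(_ c_le isT kn).
  set test := (X in if X then _ else _) => step.
  rewrite /mix_choose wp_if; set guard := holds m _.
  have -> : guard = test.
    rewrite /guard /test !holdsE !evalE iE jE in_n countE maxE !ltr_nat !truncn_nat.
    by case: (ltnP j n) => [j_lt|_]; rewrite ?andbF // !src // !truncn_nat in_1 in_2.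
  case: ifP step => [/andP[i_lt _]|_] [tk].
    have i_n := leq_trans i_lt c_le.
    move=> tE'; rewrite wp_seq wp_if; do 3! reads (iE, src i i_n, in_1).
    (* Both outcomes of the minimum change array 17 only, so the rest of the branch is verified once
       for any such memory. *)
    have min_ok L' m2 : (forall A' x, A' != 17%N -> m2 A' x = m A' x) ->
        m2 17%N 0%N = L' ->
        L' = (if m 17%N 0%N <= m 16%N 0%N - a (nth 0%N s i) then m 17%N 0%N
              else m 16%N 0%N - a (nth 0%N s i)) ->
        wp (Store 7 (var 8) (Cell 6 (var 9)) ;; incr 9) m2 (fun m1 =>
          [/\ forall A' x, A' \notin [:: 7%N; 9%N; 11%N; 17%N] -> m1 A' x = m A' x,
              holds_seq m1 7 k.+1 t & choosing k.+1 m m1]).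
      move=> m2E L'E L'min.
      do 4! execute (m2E 8%N 0%N isT, m2E 9%N 0%N isT, m2E 6%N i isT, kE, iE, src i i_n).
      split.
      - move=> A' x; rewrite !inE !negb_or !updateE => /and4P[/negPf -> /negPf -> _ ?] /=.
        exact: m2E.
      - by move=> x xk; rewrite !updateE /= m2E //; apply: dstS.
      - exists i.+1, j; rewrite !updateE /= m2E // L'E L'min tk.
        by rewrite i_lt c_j; split=> //; split; first by lia.
    case: ifP => L_le; rewrite ?wp_skip ?wp_set.
      by apply: min_ok; rewrite ?L_le.
    do 3! reads (iE, src i i_n, in_1).
    apply: min_ok; rewrite ?updateE ?L_le //=.
    by move=> A' x /negPf A'17; rewrite updateE A'17.
  move=> j_lt tE'; do 4! execute (kE, jE, src j j_lt).
  split.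
  - move=> A' x; rewrite !inE !negb_or !updateE.
    by move=> /and4P[/negPf -> _ /negPf -> _].
  - by move=> x xk; rewrite !updateE /=; apply: dstS.
  - exists i, j.+1; rewrite !updateE /= tk.
    by rewrite i_c leqW //; split=> //; split; first by lia.
move=> m1 [m1E {}dst {i j iE jE i_c c_j j_n kc tE}].
move=> [i [j [iE jE ic_j j_n [kc tE]]]].
have xE : m1 7%N k = (nth 0%N t k)%:R by apply: dst.
set x := nth 0%N t k in tE xE *.
have begin2E : begin2 A B k = Num.max (psum A k + a x) (finish2 A B k).
  by rewrite /begin2 psumS A_nth.
rewrite /mix_time.
do 6! execute (m1E 16%N 0%N isT, m1E 18%N 0%N isT, m1E 19%N 0%N isT, m1E 8%N 0%N isT,
  m1E 1%N x isT, m1E 2%N x isT, xE, kE, in_1, in_2, t1E).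
rewrite wp_if; do 3! execute (m1E 19%N 0%N isT, t2E).
have mixingS m2 :
    (forall A' y, A' \notin [:: 4%N; 8%N; 16%N; 18%N; 19%N] -> m2 A' y = m1 A' y) ->
    m2 8%N 0%N = k.+1%:R -> m2 18%N 0%N = psum A k + a x ->
    m2 19%N 0%N = begin2 A B k + b x ->
    (forall y, m2 4%N y = if y == x then begin2 A B k else m1 4%N y) ->
    m2 16%N 0%N = m 16%N 0%N + (b x - a x) -> mixing k.+1 m2.
  move=> m2E k2 t12 t22 S22 D2.
  split=> //.
  - by split=> *; rewrite m2E ?m1E.
  - by rewrite m2E // m1E.
  - by rewrite m2E // m1E.
  - by move=> y yn; rewrite m2E // m1E // src.
  - by move=> y yk; rewrite m2E // dst.
  - by rewrite t12 psumS A_nth.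
  - by rewrite t22 finish2S B_nth.
  - move=> y yk; have y_n : (y < n)%N by lia.
    rewrite S22 m1E // nth_t_eq //.
    by move: yk; rewrite ltnS leq_eqVlt; case: eqVneq => [->|_] //= ?; apply: S2E.
  - by exists i, j; rewrite D2 (m2E 9%N) // (m2E 11%N) // (m2E 17%N).
case: ifP => t12.
  have b2 : begin2 A B k = finish2 A B k by rewrite begin2E max_r.
  do 5! execute (m1E 19%N 0%N isT, m1E 8%N 0%N isT, m1E 2%N x isT, t2E, xE, kE, in_2).
  apply: mixingS; rewrite ?updateE /= ?b2 //.
  by move=> A' y; rewrite !inE !negb_or !updateE =>
    /and5P[/negPf -> /negPf -> /negPf -> /negPf -> /negPf ->].
have b2 : begin2 A B k = psum A k + a x.
  by rewrite begin2E max_l // ltW // ltNge t12.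
do 5! execute (m1E 19%N 0%N isT, m1E 8%N 0%N isT, m1E 2%N x isT, t2E, xE, kE, in_2).
apply: mixingS; rewrite ?updateE /= ?b2 //.
by move=> A' y; rewrite !inE !negb_or !updateE =>
    /and5P[/negPf -> /negPf -> /negPf -> /negPf -> /negPf ->].
Qed.

Lemma mix_runs m : prepared m -> holds_seq m 6 n s ->
  runs mix_prog m (max_cost mix_init + loop_cost (mix_choose ;; mix_time)) (mixing n).
Proof.
move=> prep src; apply/runs_seq/wp_runs.
have [[in_n in_c in_1 in_2] _ countE maxE [z16 z17 z18 z19]] := prep.
rewrite /mix_init; do 4! execute countE.
apply: runs_while => [k m1||].
- exact: mix_body_step.
- by move=> m1 [[in_n1 _ _ _] _ _ _ kE _ _ _ _ _]; rewrite holdsE !evalE kE in_n1 ltxx.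
split; rewrite ?updateE /= ?psum0 //.
exists 0%N, c; rewrite leqnn c_le; split=> //; split=> //.
by rewrite !drop0 z16 z17.
Qed.

Record placing (r : nat) (m : memory R) : Prop := Placing {
  placing_inputs : inputs m;
  placing_k : m 8%N 0%N = (n - r)%:R;
  placing_seq : holds_seq m 7 n t;
  placing_start2 : forall x, (x < n)%N -> m 4%N (nth 0%N t x) = begin2 A B x;
  placing_time : m 19%N 0%N = begin1 n A B (n - r);
  placing_start1 : forall x, (n - r <= x < n)%N -> m 3%N (nth 0%N t x) = begin1 n A B x
}.

Lemma mixing_placing m : mixing n m -> placing 0 m.
Proof.
case=> in_m _ _ _ kE dst _ t2E S2E _; split; rewrite ?subn0 ?begin1_n //.
by move=> x; rewrite ltnNge andbN.
Qed.

Lemma back_body_step r m : (r < n)%N -> placing r m ->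
  holds m (Le (Const 1) (var 8)) /\
  runs back_body m (max_cost back_body) (placing r.+1).
Proof.
move=> rn [[in_n in_c in_1 in_2] kE dst S2E tE S1E].
split; first by rewrite !holdsE !evalE kE ler_nat subn_gt0.
set k := (n - r.+1)%N; have kS : (n - r = k.+1)%N by rewrite /k; lia.
have kn : (k < n)%N by rewrite /k; lia.
have kE' : (k.+1%:R : R) - 1 = k%:R by rewrite -natr1 addrK.
rewrite kS in kE tE S1E.
have xE := dst k kn; have S2k := S2E k kn; set x := nth 0%N t k in xE S2k.
apply: wp_runs; rewrite /back_body wp_seq wp_set; do 2! reads (kE, kE').
rewrite wp_seq wp_if; do 3! reads (kE, kE', xE, S2k, tE).
have placingS m2 : (forall A' y, A' \notin [:: 3%N; 8%N; 19%N] -> m2 A' y = m A' y) ->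
    m2 8%N 0%N = k%:R -> m2 19%N 0%N = begin1 n A B k ->
    (forall y, m2 3%N y = if y == x then begin1 n A B k else m 3%N y) ->
    placing r.+1 m2.
  move=> m2E k2 t2 S12; split=> //.
  - by split=> *; rewrite m2E.
  - by move=> y yn; rewrite m2E // dst.
  - by move=> y yn; rewrite m2E // S2E.
  - move=> y /andP[ky yn]; rewrite S12 nth_t_eq //; case: eqVneq => [-> //|ynk].
    by apply: S1E; rewrite yn andbT ltn_neqAle eq_sym ynk.
have begin1k := begin1E A B kn; rewrite -?(A_nth kn) in begin1k.
case: leP begin1k => ltE begin1k; rewrite ?wp_skip ?wp_set.
  do 5! execute (kE, kE', xE, S2k, tE, in_1).
  apply: placingS; rewrite ?updateE /= ?begin1k ?A_nth //.
  by move=> A' y; rewrite !inE !negb_or !updateE => /and3P[/negPf -> /negPf -> /negPf ->].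
do 5! execute (kE, kE', xE, S2k, tE, in_1).
apply: placingS; rewrite ?updateE /= ?begin1k ?A_nth //.
by move=> A' y; rewrite !inE !negb_or !updateE => /and3P[/negPf -> /negPf -> /negPf ->].
Qed.

Lemma back_runs m : placing 0 m ->
  runs back_prog m (n * (test_cost (Le (Const 1) (var 8)) + max_cost back_body).+1 +
    (test_cost (Le (Const 1) (var 8))).+1) (placing n).
Proof.
move=> pl; apply: runs_while => // [r m1|m1].
- exact: back_body_step.
- by case=> _ kE _ _ _ _; rewrite holdsE !evalE kE ler_nat subnn.
Qed.

Lemma placing_optimal m : placing n m -> optimal I (output n m).
Proof.
case=> _ _ _ S2E _ S1E.
have [jobsE psP qsQ ps_sorted qs_sorted] := sorted_split perm_s sorted_s.
have opt := optimal_timetable jobsE psP qsQ ps_sorted qs_sorted capacity_ge.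
have nth_t (j : 'I_n) : nth 0%N t (index (j : nat) t) = j.
  by rewrite nth_index // (perm_mem perm_t) mem_iota /=.
have index_lt (j : 'I_n) : (index (j : nat) t < n)%N.
  by rewrite -[X in (_ < X)%N]size_t index_mem (perm_mem perm_t) mem_iota /=.
apply: optimal_ext opt => j /=.
  by rewrite -[in LHS](nth_t j) S1E // subnn index_lt.
by rewrite -[in LHS](nth_t j) S2E // index_lt.
Qed.

End MixLoop.

Definition scheduler_cost : nat :=
  (loop_cost init_body +
   (max_cost (set_var 13 (Const 1)) +
     (up_log 2 n * (test_cost (less (var 13) (var 0)) + sort_body_cost).+1 +
       (test_cost (less (var 13) (var 0))).+1) +
   (max_cost mix_init + loop_cost (mix_choose ;; mix_time) +
     (n * (test_cost (Le (Const 1) (var 8)) + max_cost back_body).+1 +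
       (test_cost (Le (Const 1) (var 8))).+1))))%N.

Lemma scheduler_runs :
  runs scheduler (input I) scheduler_cost (fun m => optimal I (output n m)).
Proof.
apply: runs_seq; apply: runs_weaken init_runs => // m1 init1.
apply: runs_seq; apply: runs_weaken (sort_runs init1) => // m2 sort2.
have [s [perm_s sorted_s src]] := sorted_seq sort2.
have [prep _ _] := sort2.
apply: runs_seq; apply: runs_weaken (mix_runs perm_s sorted_s prep src) => // m3.
move=> /mixing_placing /(back_runs perm_s sorted_s).
by apply: runs_weaken => // m4; apply: placing_optimal.
Qed.

End Scheduler.

(** * Running time *)

Lemma nlogn_bound (c0 c1 c2 c3 : nat) :
  bigO (fun n => c0 + n * c1 + up_log 2 n * (c2 + n * c3))%N nlogn.
Proof.
(* For [n >= 2] the rounded-down logarithm is positive, so the rounded-up one is at most twice as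
   large; this is the origin of the factors 2 and of the threshold, as [nlogn] vanishes at 1. *)
exists (c0 + c1 + 2 * c2 + 2 * c3)%N, 2%N => n n2; rewrite /nlogn.
have lg1 : (0 < trunc_log 2 n)%N by rewrite trunc_log_gt0.
have lg2 : (up_log 2 n <= 2 * trunc_log 2 n)%N.
  have : (up_log 2 n <= (trunc_log 2 n).+1)%N.
    by apply: up_log_min => //; apply: ltnW; apply: trunc_log_ltn.
  lia.
set l := trunc_log 2 n in lg1 lg2 *; set u := up_log 2 n in lg2 *.
have : (u * (c2 + n * c3) <= 2 * l * (c2 + n * c3))%N by rewrite leq_mul2r lg2 orbT.
have h0 : (c0 <= c0 * (n * l))%N by rewrite leq_pmulr // muln_gt0 lg1; lia.
have h1 : (n * c1 <= c1 * (n * l))%N.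
  by rewrite mulnC leq_mul2l leq_pmulr ?orbT.
have h2 : (2 * l * c2 <= 2 * c2 * (n * l))%N.
  by rewrite mulnAC leq_mul2l leq_pmull ?orbT //; lia.
rewrite mulnDr; lia.
Qed.

Lemma scheduler_cost_bigO : bigO scheduler_cost nlogn.
Proof.
(* The cost of each piece of code is a fixed numeral; 1000 is a generous upper bound for every
   coefficient. *)
have [c [n0 bound]] := nlogn_bound 1000 1000 1000 1000.
exists c, n0 => n /bound; apply: leq_trans.
rewrite /scheduler_cost /sort_body_cost /loop_cost /=.
by move: (up_log 2 n) => u; rewrite /= /maxn /=; lia.
Qed.

Theorem theorem2 :
  exists (p : program) (T : nat -> nat),
    bigO T nlogn /\
    forall (R : archiRealFieldType) (n : nat) (I : instance R n),
      7 / 2 * amax I + Num.max (1 / 2 * amax I) (bmax I) <= capacity I ->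
      exists (t : nat) (m : memory R),
        [/\ exec p (input I) t m, (t <= T n)%N & optimal I (output n m)].
Proof.
exists scheduler, scheduler_cost; split; first exact: scheduler_cost_bigO.
move=> R n I cap.
have cap3 : 3 * amax I + bmax I <= capacity I.
  have : bmax I <= Num.max (1 / 2 * amax I) (bmax I) by rewrite le_max lexx orbT.
  have := amax_ge0 I.
  lra.
have [t [m [ex tc opt]]] := scheduler_runs cap3.
by exists t, m.
Qed.
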